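(* Let $K$ be a field, let $F$ be the free group on $b,c$, let $\alpha$ be the automorphism of $F$ with $\alpha(b)=c$ and $\alpha(c)=b^{-1}$, let $G=F\rtimes_\alpha\langle a\rangle$ with $\langle a\rangle$ infinite cyclic, and let $S\subseteq G$ be the submonoid generated by $a$ and $b$. Then the semigroup algebra $$K[S]=K\langle a,b\mid ba^2b=a^2,\ a^4b=ba^4\rangle$$ is a finitely presented atomic domain that satisfies neither the ascending chain condition on principal right ideals nor the ascending chain condition on principal left ideals. In particular, the domain $K[S]$ does not have bounded factorizations.
   Context: In $G=F\rtimes_\alpha\langle a\rangle$ conjugation by $a$ acts as $\alpha$: $aba^{-1}=c$ and $aca^{-1}=b^{-1}$. $K[S]$ is the semigroup (monoid) algebra of $S$ over $K$, and $K\langle a,b\mid\cdots\rangle$ denotes the unital associative $K$-algebra with the indicated generators and relations. For a domain $R$ (not necessarily commutative), put $R^\bullet=R\setminus\{0\}$. A nonunit $u\in R^\bullet$ is an atom if $u=xy$ with $x,y\in R^\bullet$ implies that $x$ or $y$ is a unit. $R$ is atomic if every nonunit of $R^\bullet$ is a finite product of atoms. $R$ has bounded factorizations if it is atomic and for every $x\in R^\bullet$ there is $\lambda(x)\in\mathbb{Z}_{\ge 0}$ such that $k\le\lambda(x)$ whenever $x=u_1\cdots u_k$ with atoms $u_i$. *)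

(* Defs.v *)
From HB Require Import structures.
From mathcomp Require Import all_boot all_order all_algebra.
From mathcomp Require Import finmap monalg.
From mathcomp Require Import boolp.

Set Implicit Arguments.
Unset Strict Implicit.
Unset Printing Implicit Defensive.

Import Order.TTheory GRing.Theory Num.Theory.

Local Open Scope group_scope.

(** The free group on [I] is the set of reduced words in the letters
    [(i, false)] (the generator i) and [(i, true)] (its inverse).
    The product is concatenation followed by cancellation. *)

Section FreeGroup.
Variable I : choiceType.

Local Notation letter := (I * bool)%type.

Definition linv (x : letter) : letter := (x.1, ~~ x.2).

Lemma linvK : involutive linv.
Proof. by case=> i e; rewrite /linv /= negbK. Qed.

Definition reduced : pred (seq letter) := sorted (fun x y => y != linv x).

Record free_group : predArgType :=
  FreeGroup { fg_word :> seq letter; _ : reduced fg_word }.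

HB.instance Definition _ := [isSub for fg_word].
HB.instance Definition _ := [Choice of free_group by <:].

Definition push (x : letter) (w : seq letter) : seq letter :=
  if w is y :: w' then if y == linv x then w' else x :: w else [:: x].

Lemma reduced_behead x w : reduced (x :: w) -> reduced w.
Proof. exact: path_sorted. Qed.

Lemma reduced_push x w : reduced w -> reduced (push x w).
Proof.
case: w => [//|y w] red_w /=; case: ifPn => [_|yNx]; first exact: path_sorted red_w.
by rewrite /reduced /= yNx.
Qed.

Lemma reduced_foldr_push u w : reduced w -> reduced (foldr push w u).
Proof. by move=> red_w; elim: u => //= x u; apply: reduced_push. Qed.

Lemma pushK x w : reduced w -> push (linv x) (push x w) = w.
Proof.
case: w => [|y w] red_w /=; first by rewrite linvK eqxx.
case: ifPn => [/eqP yE|_] /=; last by rewrite linvK eqxx.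
case: w red_w => [|z w]; first by rewrite yE.
by rewrite /reduced yE /= => /andP[/negbTE ->].
Qed.

Lemma pushVK x w : reduced w -> push x (push (linv x) w) = w.
Proof. by move=> red_w; rewrite -{1}(linvK x) pushK. Qed.

Lemma foldr_push x u w : reduced w ->
  foldr push w (push x u) = push x (foldr push w u).
Proof.
move=> red_w; case: u => [//|y u] /=; case: ifP => [/eqP ->|//].
by rewrite pushVK // reduced_foldr_push.
Qed.

Lemma foldr_pushA u v w : reduced w ->
  foldr push w (foldr push v u) = foldr push (foldr push w v) u.
Proof. by move=> red_w; elim: u => //= x u IHu; rewrite foldr_push ?IHu. Qed.

Lemma foldr_push_nil u : reduced u -> foldr push [::] u = u.
Proof.
elim: u => //= x u IHu red_u; rewrite IHu ?(reduced_behead red_u) //.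
by case: u red_u {IHu} => //= y u; rewrite /reduced /= => /andP[/negbTE ->].
Qed.

Lemma reduced_winv u : reduced u -> reduced (rev (map linv u)).
Proof.
rewrite /reduced rev_sorted sorted_map; apply: sub_sorted => x y /=.
by rewrite linvK eq_sym.
Qed.

Lemma foldr_pushVK u w : reduced w ->
  foldr push (foldr push w u) (rev (map linv u)) = w.
Proof.
elim: u w => //= x u IHu w red_w.
by rewrite rev_cons foldr_rcons pushK ?IHu // reduced_foldr_push.
Qed.

Lemma winvK u : rev (map linv (rev (map linv u))) = u.
Proof. by rewrite map_rev revK -map_comp (eq_map linvK) map_id. Qed.

Definition fg_one : free_group := @FreeGroup [::] isT.

Definition fg_mul (u v : free_group) : free_group :=
  FreeGroup (reduced_foldr_push u (valP v)).

Definition fg_inv (u : free_group) : free_group :=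
  FreeGroup (reduced_winv (valP u)).

Lemma fg_mulA : associative fg_mul.
Proof. by move=> u v w; apply: val_inj; rewrite /= foldr_pushA ?(valP w). Qed.

Lemma fg_mul1 : left_id fg_one fg_mul.
Proof. by move=> u; apply: val_inj. Qed.

Lemma fg_mulr1 : right_id fg_one fg_mul.
Proof. by move=> u; apply: val_inj; rewrite /= foldr_push_nil ?(valP u). Qed.

Lemma fg_mulV : left_inverse fg_one fg_inv fg_mul.
Proof.
move=> u; apply: val_inj => /=.
by have := @foldr_pushVK u [::] isT; rewrite foldr_push_nil ?(valP u).
Qed.

Lemma fg_mulrV : right_inverse fg_one fg_inv fg_mul.
Proof.
move=> u; have uK : fg_inv (fg_inv u) = u.
  by apply: val_inj; rewrite /= winvK.
by rewrite -{1}uK fg_mulV.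
Qed.

HB.instance Definition _ :=
  isGroup.Build free_group fg_mulA fg_mul1 fg_mulr1 fg_mulV fg_mulrV.

Definition fg_gen (i : I) : free_group := @FreeGroup [:: (i, false)] isT.

Lemma fg_gen_exp i n : fg_gen i ^+ n = nseq n (i, false) :> seq letter.
Proof.
elim: n => [//|n IHn]; rewrite expgS /= IHn.
by case: n {IHn} => //= n; rewrite /linv xpair_eqE eqxx.
Qed.

Section Lift.
Variables (H : groupType) (f : I -> H).

Definition letter_val (x : letter) : H := if x.2 then (f x.1)^-1 else f x.1.

Definition fg_lift (u : free_group) : H := \prod_(x <- fg_word u) letter_val x.

Lemma letter_valV x : letter_val (linv x) = (letter_val x)^-1.
Proof. by case: x => i []; rewrite /letter_val /= ?invgK. Qed.

Lemma prod_push x w :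
  \prod_(y <- push x w) letter_val y = letter_val x * \prod_(y <- w) letter_val y.
Proof.
case: w => [|y w] /=; first by rewrite big_cons.
case: ifP => [/eqP ->|_]; last by rewrite big_cons.
by rewrite big_cons letter_valV mulgA mulgV mul1g.
Qed.

Lemma fg_liftM : {morph fg_lift : u v / u * v}.
Proof.
case=> u red_u v; rewrite /fg_lift /=; elim: u {red_u} => [|x u IHu] /=.
  by rewrite big_nil mul1g.
by rewrite prod_push IHu big_cons mulgA.
Qed.

HB.instance Definition _ :=
  monoid.isMultiplicative.Build free_group H fg_lift fg_liftM.

Lemma fg_lift_gen i : fg_lift (fg_gen i) = f i.
Proof. by rewrite /fg_lift big_cons big_nil mulg1. Qed.

Lemma fg_lift_uniq (g : free_group -> H) : {morph g : u v / u * v} ->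
  (forall i, g (fg_gen i) = f i) -> g =1 fg_lift.
Proof.
move=> gM gE [u red_u].
have g1 : g 1 = 1 by apply: (mulgI (g 1)); rewrite -gM !mulg1.
have gV v : g v^-1 = (g v)^-1.
  by apply: (mulgI (g v)); rewrite -gM !mulgV g1.
elim: u red_u => [|x u IHu] red_u.
  by rewrite /fg_lift big_nil -g1; congr (g _); apply: val_inj.
have lE : @FreeGroup [:: x] isT = if x.2 then (fg_gen x.1)^-1 else fg_gen x.1.
  by apply: val_inj; case: x {red_u} => i [].
have -> : FreeGroup red_u = @FreeGroup [:: x] isT * FreeGroup (reduced_behead red_u).
  apply: val_inj => /=; case: u red_u {IHu} => //= y u.
  by rewrite /reduced /= => /andP[/negbTE ->].
rewrite gM IHu fg_liftM; congr (_ * _).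
rewrite /fg_lift big_cons big_nil mulg1 lE /letter_val.
by case: x.2; rewrite ?gV gE.
Qed.

End Lift.
End FreeGroup.

Record automorphism (F : groupType) := Automorphism {
  aut_fun :> F -> F;
  aut_inv : F -> F;
  aut_morph : {morph aut_fun : x y / x * y};
  aut_funK : cancel aut_fun aut_inv;
  aut_invK : cancel aut_inv aut_fun
}.

(** The pair (x, n) stands for x a^n, where a is the generator of the infinite
    cyclic factor; conjugation by a acts on F as the automorphism. *)
Definition sdprodZ (F : groupType) of automorphism F : Type := (F * int)%type.

Section SemidirectProduct.
Variables (F : groupType) (s : automorphism F).

Definition aut_zpow (n : int) : F -> F :=
  match n with
  | Posz k => iter k s
  | Negz k => iter k.+1 (aut_inv s)
  end.

Lemma aut_inv_morph : {morph aut_inv s : x y / x * y}.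
Proof.
by move=> x y; apply: (can_inj (aut_funK s)); rewrite aut_morph !aut_invK.
Qed.

Lemma aut_zpowM n : {morph aut_zpow n : x y / x * y}.
Proof.
move=> x y; case: n => n /=; first by elim: n => //= n ->; rewrite aut_morph.
by elim: n => /= [|n ->]; rewrite aut_inv_morph.
Qed.

Lemma aut_zpow1 n : aut_zpow n 1 = 1.
Proof. by apply: (mulgI (aut_zpow n 1)); rewrite -aut_zpowM !mulg1. Qed.

Lemma aut_zpowS n x : aut_zpow (1 + n)%R x = s (aut_zpow n x).
Proof.
case: n => [n //|[|n]]; first by rewrite /= aut_invK.
rewrite (_ : 1 + Negz n.+1 = Negz n)%R /= ?aut_invK //.
by rewrite !NegzE -[n.+2]addn1 PoszD opprD addrC subrK.
Qed.

Lemma aut_zpowP n x : aut_zpow (- 1 + n)%R x = aut_inv s (aut_zpow n x).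
Proof. by rewrite -[n in RHS](addNKr 1%R) aut_zpowS aut_funK. Qed.

Lemma aut_zpowD m n x : aut_zpow (m + n)%R x = aut_zpow m (aut_zpow n x).
Proof.
case: m => m.
  elim: m => [|m IHm] /=; first by rewrite add0r.
  by rewrite -add1n PoszD -addrA aut_zpowS IHm.
elim: m => [|m IHm]; first by rewrite (aut_zpowP n).
have -> : (Negz m.+1 = - 1 + Negz m)%R by rewrite !NegzE -opprD -PoszD add1n.
by rewrite -addrA !aut_zpowP IHm.
Qed.

HB.instance Definition _ := Choice.on (sdprodZ s).

Definition sd_one : sdprodZ s := (1, 0%R).

Definition sd_mul (g h : sdprodZ s) : sdprodZ s :=
  (g.1 * aut_zpow g.2 h.1, (g.2 + h.2)%R).

Definition sd_inv (g : sdprodZ s) : sdprodZ s :=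
  (aut_zpow (- g.2)%R g.1^-1, (- g.2)%R).

Lemma sd_mulA : associative sd_mul.
Proof.
by move=> g h k; rewrite /sd_mul /= aut_zpowM aut_zpowD mulgA addrA.
Qed.

Lemma sd_mul1 : left_id sd_one sd_mul.
Proof. by case=> x n; rewrite /sd_mul /= mul1g add0r. Qed.

Lemma sd_mulr1 : right_id sd_one sd_mul.
Proof. by case=> x n; rewrite /sd_mul /= aut_zpow1 mulg1 addr0. Qed.

Lemma sd_mulV : left_inverse sd_one sd_inv sd_mul.
Proof.
by case=> x n; rewrite /sd_mul /= -aut_zpowM mulVg aut_zpow1 addNr.
Qed.

Lemma sd_mulrV : right_inverse sd_one sd_inv sd_mul.
Proof.
by case=> x n; rewrite /sd_mul /= -aut_zpowD subrr mulgV.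
Qed.

HB.instance Definition _ :=
  isGroup.Build (sdprodZ s) sd_mulA sd_mul1 sd_mulr1 sd_mulV sd_mulrV.

Definition sd_inj (x : F) : sdprodZ s := (x, 0%R).

Definition sd_gen : sdprodZ s := (1, 1%R).

Lemma sd_injM : {morph sd_inj : x y / x * y}.
Proof. by []. Qed.

Lemma sd_conj x : sd_gen * sd_inj x * sd_gen^-1 = sd_inj (s x).
Proof.
have aV : sd_gen^-1 = (1, (- 1)%R) :> sdprodZ s.
  by congr (_, _); rewrite /= invg1; apply: (aut_zpow1 (- 1)%R).
rewrite aV; congr (_, _); rewrite /= mul1g.
by have /= -> := aut_zpow1 1%R; rewrite mulg1.
Qed.

End SemidirectProduct.

Inductive submonoid_gen (G : monoidType) (X : G -> Prop) : G -> Prop :=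
| SubmonoidIn x of X x : submonoid_gen X x
| SubmonoidOne : submonoid_gen X 1
| SubmonoidMul x y of submonoid_gen X x & submonoid_gen X y :
    submonoid_gen X (x * y).

(* Free on b = [fb] and c = [fc]. *)
Definition F : Type := free_group bool.
HB.instance Definition _ := Group.on F.

Definition fb : F := fg_gen false.
Definition fc : F := fg_gen true.

Definition alpha_fun : F -> F := fg_lift (fun i : bool => if i then fb^-1 else fc).
Definition alpha_inv : F -> F := fg_lift (fun i : bool => if i then fb else fc^-1).

Lemma alpha_funM : {morph alpha_fun : x y / x * y}.
Proof. exact: fg_liftM. Qed.

Lemma alpha_invM : {morph alpha_inv : x y / x * y}.
Proof. exact: fg_liftM. Qed.

Lemma fg_endo_id (g : F -> F) : {morph g : x y / x * y} ->
  g fb = fb -> g fc = fc -> g =1 id.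
Proof.
move=> gM gb gc w; rewrite (fg_lift_uniq (f := @fg_gen bool) gM); last by case.
by rewrite -(fg_lift_uniq (g := idfun)).
Qed.

Lemma mulg_morphV (g : F -> F) : {morph g : x y / x * y} -> {morph g : x / x^-1}.
Proof.
move=> gM x; have g1 : g 1 = 1 by apply: (mulgI (g 1)); rewrite -gM !mulg1.
by apply: (mulgI (g x)); rewrite -gM !mulgV.
Qed.

Lemma alpha_funK : cancel alpha_fun alpha_inv.
Proof.
apply: fg_endo_id => [x y||]; first by rewrite alpha_funM alpha_invM.
  by rewrite /alpha_fun fg_lift_gen /alpha_inv fg_lift_gen.
rewrite /alpha_fun fg_lift_gen (mulg_morphV alpha_invM).
by rewrite /alpha_inv fg_lift_gen invgK.
Qed.

Lemma alpha_invK : cancel alpha_inv alpha_fun.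
Proof.
apply: fg_endo_id => [x y||]; first by rewrite alpha_invM alpha_funM.
  rewrite /alpha_inv fg_lift_gen (mulg_morphV alpha_funM).
  by rewrite /alpha_fun fg_lift_gen invgK.
by rewrite /alpha_inv fg_lift_gen /alpha_fun fg_lift_gen.
Qed.

Definition alpha : automorphism F :=
  Automorphism alpha_funM alpha_funK alpha_invK.

Lemma alpha_b : alpha fb = fc.
Proof. exact: fg_lift_gen. Qed.

Lemma alpha_c : alpha fc = fb^-1.
Proof. exact: fg_lift_gen. Qed.

Definition G : Type := sdprodZ alpha.
HB.instance Definition _ := Group.on G.

Definition ga : G := sd_gen alpha.
Definition gb : G := sd_inj alpha fb.
Definition gc : G := sd_inj alpha fc.

Lemma ga_conj_b : ga * gb * ga^-1 = gc.
Proof. by rewrite /gc -alpha_b; apply: sd_conj. Qed.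

Lemma ga_conj_c : ga * gc * ga^-1 = gb^-1.
Proof. by rewrite /gc sd_conj alpha_c. Qed.

Definition inS : pred G :=
  fun g => `[< submonoid_gen (fun x => x = ga \/ x = gb) g >].

Lemma inS_closed : monoid_closed inS.
Proof.
split; first by apply/asboolP/SubmonoidOne.
by move=> g h /asboolP Sg /asboolP Sh; apply/asboolP/SubmonoidMul.
Qed.

Definition Smon : Type := {g : G | inS g}.
HB.instance Definition _ := SubChoice.on Smon.
HB.instance Definition _ := SubChoice_isSubMonoid.Build G inS Smon inS_closed.

Lemma inS_ga : inS ga.
Proof. by apply/asboolP/SubmonoidIn; left. Qed.

Lemma inS_gb : inS gb.
Proof. by apply/asboolP/SubmonoidIn; right. Qed.

Definition sa : Smon := Sub ga inS_ga.
Definition sb : Smon := Sub gb inS_gb.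

(* [monomType] requires that 1 be the only invertible element of S. *)
Lemma inS_deg g : inS g -> (0 <= g.2)%R /\ (g.2 = 0%R -> exists n, g.1 = fb ^+ n).
Proof.
move=> /asboolP; elim => {g} [g [->|->]||g h _ [g0 gE] _ [h0 hE]] /=.
- by [].
- by split=> // _; exists 1%N; rewrite expg1.
- by split=> // _; exists 0%N.
split; first exact: addr_ge0.
move=> /eqP; rewrite paddr_eq0 // => /andP[/eqP g2 /eqP h2].
have [[m ->] [n ->]] := (gE g2, hE h2).
by exists (m + n)%N; rewrite g2 expgnDr.
Qed.

Lemma smon_eq1 (x y : Smon) : x * y = 1 -> x = 1 /\ y = 1.
Proof.
move=> /(congr1 val); rewrite valM => xy1.
have [x0 xE] := inS_deg (valP x); have [y0 yE] := inS_deg (valP y).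
have /eqP : ((val x).2 + (val y).2 = 0)%R := congr1 snd xy1; rewrite paddr_eq0 // => /andP[/eqP x2 /eqP y2].
have [[m xm] [n yn]] := (xE x2, yE y2).
have bE : fb ^+ (m + n) = 1.
  by rewrite expgnDr -xm -yn; move: (congr1 fst xy1 : (val x).1 * aut_zpow alpha (val x).2 (val y).1 = 1);
  rewrite x2.
have /(congr1 size) : fb ^+ (m + n) = [::] :> seq _ by rewrite bE.
rewrite fg_gen_exp size_nseq => /eqP; rewrite addn_eq0 => /andP[/eqP m0 /eqP n0].
split; apply: val_inj; rewrite val1.
  by move: x2 xm; rewrite m0; case: (val x) => u k /= -> ->.
by move: y2 yn; rewrite n0; case: (val y) => u k /= -> ->.
Qed.

HB.instance Definition _ :=
  Choice_isMonomialDef.Build Smon (@mulgA Smon) (@mul1g Smon) (@mulg1 Smon) smon_eq1.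

Local Open Scope ring_scope.

(* [monalg] makes [{malg K[M]}] an [algType] only for commutative M. *)
Definition monoid_algebra (K : comNzRingType) (M : monomType) : Type := {malg K[M]}.

Section MonoidAlgebra.
Variables (K : comNzRingType) (M : monomType).

HB.instance Definition _ := GRing.Lalgebra.on (monoid_algebra K M).

Lemma monoid_algebra_scaleAr (k : K) (x y : monoid_algebra K M) :
  k *: (x * y) = x * (k *: y).
Proof.
rewrite -!mul_malgC mulrA [in RHS]mulrA; congr (_ * _).
apply/malgP=> m; rewrite !malgM_def fgmulUg fgmulgU !raddf_sum /=.
by apply: eq_bigr => i _; rewrite mulrC mul1m mulm1.
Qed.

HB.instance Definition _ :=
  GRing.Lalgebra_isAlgebra.Build K (monoid_algebra K M) monoid_algebra_scaleAr.

Definition monom (m : M) : monoid_algebra K M := << m >>.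

End MonoidAlgebra.

Arguments monom {K M} m.

Definition free_algebra (K : comNzRingType) (n : nat) :=
  monoid_algebra K (fmonom 'I_n).

Definition fvar (K : comNzRingType) (n : nat) (i : 'I_n) : free_algebra K n :=
  monom (fmu i).

Inductive ideal_gen (R : nzRingType) (X : R -> Prop) : R -> Prop :=
| IdealIn x of X x : ideal_gen X x
| IdealZero : ideal_gen X 0
| IdealAdd x y of ideal_gen X x & ideal_gen X y : ideal_gen X (x + y)
| IdealMull r x of ideal_gen X x : ideal_gen X (r * x)
| IdealMulr r x of ideal_gen X x : ideal_gen X (x * r).

Section Presentation.
Variables (K : comNzRingType) (A : algType K).

(** [A] is the algebra presented by the generators [gen] and the relations
    p = q for (p, q) in [rels]. *)
Definition presented_by (n : nat) (gen : n.-tuple A)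
    (rels : seq (free_algebra K n * free_algebra K n)) : Prop :=
  exists phi : {lrmorphism free_algebra K n -> A},
    [/\ forall i, phi (fvar K i) = tnth gen i,
        forall x, exists p, phi p = x
      & forall p, phi p = 0 <->
          ideal_gen (fun r => exists2 e, e \in rels & r = e.1 - e.2) p].

Definition finitely_presented : Prop :=
  exists (n : nat) (gen : n.-tuple A)
    (rels : seq (free_algebra K n * free_algebra K n)), presented_by gen rels.

End Presentation.

Section Factorization.
Variable R : nzRingType.
Implicit Types x y u : R.

Definition is_domain : Prop := forall x y, x * y = 0 -> x = 0 \/ y = 0.

Definition is_unit x : Prop := exists y, x * y = 1 /\ y * x = 1.

Definition is_atom u : Prop :=
  [/\ u <> 0, ~ is_unit u
    & forall x y, x <> 0 -> y <> 0 -> u = x * y -> is_unit x \/ is_unit y].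

Definition is_atomic : Prop :=
  forall x, x <> 0 -> ~ is_unit x ->
    exists2 s : seq R, forall u, u \in s -> is_atom u & x = \prod_(u <- s) u.

Definition has_bounded_factorizations : Prop :=
  is_atomic /\
  forall x, x <> 0 ->
    exists l : nat, forall s : seq R,
      (forall u, u \in s -> is_atom u) -> x = \prod_(u <- s) u -> (size s <= l)%N.

Definition right_ideal1 x y : Prop := exists r, y = x * r.
Definition left_ideal1 x y : Prop := exists r, y = r * x.

(** The ascending chain condition on the sets [I x], for [x : R]. *)
Definition acc_on (I : R -> R -> Prop) : Prop :=
  forall x : nat -> R,
    (forall n y, I (x n) y -> I (x n.+1) y) ->
    exists N, forall n, (N <= n)%N -> forall y, I (x n) y <-> I (x N) y.

Definition accp_right : Prop := acc_on right_ideal1.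
Definition accp_left : Prop := acc_on left_ideal1.

End Factorization.

(* Main.v *)
From HB Require Import structures.
Require Import Defs.
From mathcomp Require Import all_boot all_order all_algebra.
From mathcomp Require Import finmap monalg.
From mathcomp Require Import boolp zify.

Set Implicit Arguments.
Unset Strict Implicit.
Unset Printing Implicit Defensive.

Import Order.TTheory GRing.Theory Num.Theory.

(** Conjugation by a permutes the letters b, c, b^-1, c^-1 cyclically; regard
    one step of this cycle as a quarter turn.  Write an element of G as w a^n,
    with w a reduced word in b and c.  Reading w from left to right, starting
    in the direction of b, and turning forward by 0, 1, 2 or 3 quarter turns
    before each letter costs a total of T(w) quarter turns, and w a^n lies in S
    if and only if T(w) <= n ([inSP]).

    Presentation.  The element w a^n has the normal form in which the quarter
    turns are spelled out as powers of a, followed by a^(n - T(w)).  Modulo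
    the relations b a^2 b = a^2 and a^4 b = b a^4, multiplying a normal form by
    a generator on the left gives the normal form of the product ([nf_ga],
    [nf_gb]).  Hence every word is congruent to the normal form of its value in
    S, and an element of the free algebra with value 0 lies in the ideal
    ([presented_KS]).

    Domain.  The free group has a right-invariant total order.  Its positive
    cone is the set of u with [tau u > 0], where tau adds the signs of the
    letters and the signs of the corners of a reduced word; tau takes odd
    values on nontrivial elements and is superadditive up to 1.  Comparing first the
    exponents of a, one gets a right-invariant order on G, so that a product of
    two nonzero elements of K[S] has a monomial which arises only once and
    is of maximal a-degree ([exists_lead]).  Hence K[S] is a domain and
    the a-degree is additive.

    Atomicity.  By additivity of the a-degree, it is enough to factor an x which
    is not a product of two elements of positive a-degree.  The elements of
    a-degree 0 are the polynomials in b, and factor by induction on their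
    degree.  In general, let x = f y g with f and g polynomials in b.  Either
    every monomial of x is divisible by a^2 on the left up to powers of b; then
    x = b^N a^2 z, and the choice of x forces z to be a polynomial in b.  Or
    some monomial of x is not, and then it admits only finitely many powers of b
    as left factors, which bounds the degree of f ([bdeg_left_factor]).  The
    anti-automorphism of K[S] fixing a and b gives the same alternative on the
    right.  If both degrees are bounded, a factorization x = f y g of
    maximal total degree has an atom or a unit in the middle.

    Chains.  Since a^2 = b a^2 b, the right ideals generated by b^n a^2
    and the left ideals generated by a^2 b^n increase strictly; and the
    equality a^2 = b^n a a b^n shows that the atoms a and b give
    factorizations of a^2 of unbounded length. *)

(** * Letters, quarter turns and membership in S *)

Section Words.
Local Open Scope group_scope.

Local Notation letter := (bool * bool)%type.

(** Conjugation by a on the letters: b, c, b^-1, c^-1, b and so on. *)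
Definition turn (x : letter) : letter := (~~ x.1, x.1 (+) x.2).

Lemma turn_linv x : turn (linv x) = linv (turn x).
Proof. by case: x => [[] []]. Qed.

Lemma turn_inj : injective turn.
Proof. by move=> [[] []] [[] []]. Qed.

Lemma map_turn_push x w : map turn (push x w) = push (turn x) (map turn w).
Proof.
case: w => //= y w; rewrite -turn_linv (inj_eq turn_inj).
by case: ifP.
Qed.

Lemma map_turn_foldr_push u w :
  map turn (foldr (@push bool) w u) = foldr (@push bool) (map turn w) (map turn u).
Proof. by elim: u => //= x u <-; rewrite map_turn_push. Qed.

Lemma reduced_map_turn (w : seq letter) : reduced (map turn w) = reduced w.
Proof.
rewrite /reduced sorted_map; congr sorted; apply/funext=> x; apply/funext=> y /=.
by rewrite -turn_linv (inj_eq turn_inj).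
Qed.

Lemma alpha_word (u : F) : alpha u = map turn u :> seq letter.
Proof.
have red_u (v : F) : reduced (map turn v) by rewrite reduced_map_turn (valP v).
pose g (v : F) : F := FreeGroup (red_u v).
have gM : {morph g : v w / v * w}.
  by move=> v w; apply: val_inj; rewrite /= map_turn_foldr_push.
rewrite /= /alpha_fun -(fg_lift_uniq gM) //; case; exact: val_inj.
Qed.

Lemma iter_alpha_word k (u : F) :
  iter k alpha u = map (iter k turn) u :> seq letter.
Proof.
elim: k => [|k IHk] /=; first by rewrite map_id.
by rewrite [LHS]alpha_word IHk -map_comp.
Qed.

Definition letter_b : letter := (false, false).

(** The position of a letter in the cycle b, c, b^-1, c^-1. *)
Definition phase (x : letter) : nat := (x.1 + x.2.*2)%N.

Definition quarter_turns (x y : letter) : nat := ((phase y + 4 - phase x) %% 4)%N.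

(** The direction of reading starts at [x] and only turns forward, because the
    negative powers of a are not in S. *)
Fixpoint total_turns (x : letter) (w : seq letter) : nat :=
  if w is y :: w' then (quarter_turns x y + total_turns y w')%N else 0%N.

Lemma total_turns_map_turn x w : total_turns (turn x) (map turn w) = total_turns x w.
Proof.
by elim: w x => //= y w IHw x; rewrite IHw; case: x => [[] []]; case: y {IHw} => [[] []].
Qed.

Lemma total_turns_map_iter_turn k x w :
  total_turns (iter k turn x) (map (iter k turn) w) = total_turns x w.
Proof.
elim: k => [|k IHk]; first by rewrite map_id.
rewrite [map _ _](_ : _ = map turn (map (iter k turn) w)) ?total_turns_map_turn //.
by rewrite -map_comp.
Qed.

(** Turning from [x] through [y] to the first letter cannot be cheaper than
    turning there directly. *)
Lemma total_turns_le x y w : (total_turns x w <= quarter_turns x y + total_turns y w)%N.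
Proof.
case: w => //= z w; rewrite addnA leq_add2r.
by case: x => [[] []]; case: y => [[] []]; case: z => [[] []].
Qed.

Lemma iter_turn_quarter_turns x : iter (quarter_turns letter_b x) turn letter_b = x.
Proof. by case: x => [[] []]. Qed.

Definition unturn (x : letter) : letter := iter 3 turn x.

Lemma unturnK : cancel unturn turn.
Proof. by case=> [[] []]. Qed.

Lemma ga_expE k : ga ^+ k = (1, Posz k) :> G.
Proof.
elim: k => [//|k IHk]; rewrite expgS IHk.
by congr (_, _); rewrite /= mul1g; exact: (aut_zpow1 alpha 1%R).
Qed.

Lemma gb_expE k : gb ^+ k = (fb ^+ k, 0%R) :> G.
Proof.
elim: k => [//|k IHk]; rewrite !expgS IHk.
by congr (_, _).
Qed.

Lemma gaM (u : F) (n : int) : ga * ((u, n) : G) = (alpha u, (1 + n)%R) :> G.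
Proof. by congr (_, _); rewrite /= mul1g. Qed.

Lemma gbM (u : F) (n : int) : gb * ((u, n) : G) = (fb * u, n) :> G.
Proof. by congr (_, _); rewrite /= add0r. Qed.

Lemma ga_gb_expM k (u : F) (n : int) :
  ga ^+ k * (gb * ((u, n) : G)) = (iter k alpha (fb * u), (Posz k + n)%R) :> G.
Proof. by rewrite gbM ga_expE; congr (_, _); rewrite /= mul1g. Qed.

(** Spelling out the first letter as a^k b a^-k leaves the a^-k to be absorbed by
    the rest of the word: this is what turns a reduced word into a word in the
    generators of S. *)
Lemma peel_letter (w : F) (x : letter) (w' : seq letter) (n : int) :
    w = x :: w' :> seq letter ->
  exists2 u : F,
    (w, n) = ga ^+ (quarter_turns letter_b x) *
      (gb * ((u, n - Posz (quarter_turns letter_b x))%R : G)) :> G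
    & total_turns letter_b u = total_turns x w' /\ size u = size w'.
Proof.
move=> wE; set k := quarter_turns letter_b x.
have red_xw : reduced (x :: w') by rewrite -wE (valP w).
have kK : cancel (iter k unturn) (iter k turn).
  by move=> y; elim: (k) y => //= j IHj y; rewrite -iterS iterSr unturnK IHj.
have red_u : reduced (map (iter k unturn) w').
  have: reduced (map (iter k turn) (map (iter k unturn) w')).
    by rewrite -map_comp (eq_map kK) map_id (reduced_behead red_xw).
  elim: (k) (map _ w') => [|j IHj] v /=; first by rewrite map_id.
  have -> : [seq turn (iter j turn i) | i <- v] = map turn (map (iter j turn) v).
    by rewrite -map_comp.
  by rewrite reduced_map_turn => /IHj.
exists (FreeGroup red_u : F); last first.
  split=> /=; last by rewrite size_map.
  rewrite -(total_turns_map_iter_turn k) -map_comp (eq_map kK) map_id.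
  by rewrite iter_turn_quarter_turns.
rewrite ga_gb_expM addrC subrK; congr (_, _); apply: val_inj => /=.
rewrite iter_alpha_word /= -[fg_word w]/(w : seq letter) wE.
have yE : [seq iter k turn i | i <- map (iter k unturn) w'] = w'.
  by rewrite -map_comp (eq_map kK) map_id.
rewrite -{1}[x]iter_turn_quarter_turns -/k -{1}yE.
case: (map _ w') yE => [//|y v] /= vE.
case: eqP => [yE|//].
by move: red_xw; rewrite -vE /reduced /= yE; case: x @k {wE kK red_u yE vE} => [[] []].
Qed.
End Words.

Section Membership.
Local Open Scope group_scope.

(** Left multiplication by b either writes a letter in the starting direction,
    which is free, or cancels a letter, which makes the word cheaper. *)
Lemma total_turns_push_b w :
  (total_turns letter_b (push letter_b w) <= total_turns letter_b w)%N.
Proof.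
case: w => [//|y w] /=; case: eqP => [->|_ //=].
exact: total_turns_le.
Qed.

Lemma fb_word (u : F) : fb * u = push letter_b u :> seq _.
Proof. by []. Qed.

Lemma total_turns_alpha_le (u : F) :
  (total_turns letter_b (alpha u) <= 1 + total_turns letter_b u)%N.
Proof.
rewrite alpha_word -(total_turns_map_turn letter_b u).
exact: (@total_turns_le letter_b (turn letter_b)).
Qed.

Lemma submonoid_gen_ind_l (M : monoidType) (X P : M -> Prop) :
  P 1 -> (forall x g, X x -> P g -> P (x * g)) ->
  forall g, submonoid_gen X g -> P g.
Proof.
move=> P1 PM g Xg; rewrite -[g]mulg1; move: P1; move: (1 : M).
elim: Xg => {g} [x Xx h Ph||x y _ IHx _ IHy h Ph].
- exact: PM.
- by move=> h; rewrite mul1g.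
- by rewrite -mulgA; apply: IHx; apply: IHy.
Qed.

Lemma inS_gaX k : inS (ga ^+ k).
Proof.
elim: k => [|k IHk]; first by rewrite expg0; case: inS_closed.
by rewrite expgS; apply: inS_closed.2 => //; apply: inS_ga.
Qed.

(** The inequality is preserved by left multiplication by a and by b.
    Conversely, if it holds, letters can be peeled off one at a time. *)
Lemma inSP (g : G) : reflect ((total_turns letter_b g.1)%:Z <= g.2)%R (inS g).
Proof.
apply: (iffP idP) => [/asboolP|].
  elim/submonoid_gen_ind_l => // x [u n] [->|->] le_un.
    rewrite gaM; apply: le_trans (_ : 1 + Posz (total_turns letter_b u) <= _)%R.
      exact: total_turns_alpha_le.
    by rewrite lerD2l.
  rewrite gbM; apply: le_trans le_un.
  exact: total_turns_push_b.
case: g => u n /=; elim/ltn_ind: (size u) {-2}u (erefl (size u)) n => m IHm {}u um n le_un.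
case uE: (u : seq _) => [|x w].
  have -> : u = 1 by apply: val_inj.
  case: n le_un => [n _|n]; last by rewrite uE.
  by have := inS_gaX n; rewrite ga_expE.
have [v -> [vw sv]] := peel_letter n uE.
apply: inS_closed.2; first exact: inS_gaX.
apply: inS_closed.2; first exact: inS_gb.
apply: (IHm (size v)) => //; first by rewrite -um uE sv.
by move: le_un; rewrite uE vw /=; lia.
Qed.

End Membership.

(** * Normal forms and the presentation of S *)

Section IdealCongruence.
Local Open Scope ring_scope.
Variables (K : comNzRingType) (A : algType K) (X : A -> Prop).

Definition congr_mod (p q : A) : Prop := ideal_gen X (p - q).

Local Notation "p ~~ q" := (congr_mod p q) (at level 70).

Lemma congr_refl p : p ~~ p.
Proof. by rewrite /congr_mod subrr; constructor. Qed.

Lemma congr_trans q p r : p ~~ q -> q ~~ r -> p ~~ r.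
Proof.
move=> pq qr; rewrite /congr_mod -[p](subrK q) -addrA.
exact: IdealAdd.
Qed.

Lemma congrD p q p' q' : p ~~ q -> p' ~~ q' -> p + p' ~~ q + q'.
Proof. by move=> pq pq'; rewrite /congr_mod opprD addrACA; apply: IdealAdd. Qed.

Lemma congrMl r p q : p ~~ q -> r * p ~~ r * q.
Proof. by move=> pq; rewrite /congr_mod -mulrBr; apply: IdealMull. Qed.

Lemma congrMr r p q : p ~~ q -> p * r ~~ q * r.
Proof. by move=> pq; rewrite /congr_mod -mulrBl; apply: IdealMulr. Qed.

Lemma congr_sum (I : Type) (s : seq I) (E E' : I -> A) :
  (forall i, E i ~~ E' i) -> \sum_(i <- s) E i ~~ \sum_(i <- s) E' i.
Proof.
move=> EE'; elim/big_ind2: _ => // [|p p' q q'].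
  exact: congr_refl.
exact: congrD.
Qed.
End IdealCongruence.

Section NormalForms.
Local Open Scope ring_scope.
Variables (K : comNzRingType) (A : algType K) (x y : A) (X : A -> Prop).

Local Notation "p ~~ q" := (congr_mod X p q) (at level 70).

Hypothesis y_x2_y : y * x ^+ 2 * y ~~ x ^+ 2.
Hypothesis x4_y : x ^+ 4 * y ~~ y * x ^+ 4.

Fixpoint word_nf (p : bool * bool) (w : seq (bool * bool)) : A :=
  if w is z :: w' then x ^+ quarter_turns p z * (y * word_nf z w') else 1.

Definition nf (g : G) : A :=
  word_nf letter_b g.1 * x ^+ absz (g.2 - Posz (total_turns letter_b g.1)).

Lemma word_nf_map_turn p w : word_nf (turn p) (map turn w) = word_nf p w.
Proof.
elim: w p => //= z w IHw p; rewrite IHw; congr (x ^+ _ * _).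
by case: p => [[] []]; case: z {IHw} => [[] []].
Qed.

Lemma x4_word_nf p w : x ^+ 4 * word_nf p w ~~ word_nf p w * x ^+ 4.
Proof.
elim: w p => [|z w IHw] p /=; first by rewrite mulr1 mul1r; apply: congr_refl.
rewrite mulrA -exprD addnC exprD; move: (x ^+ 4) x4_y IHw => x4 x4y IHw.
rewrite -!mulrA; apply: congrMl.
apply: (@congr_trans _ _ _ (y * x4 * word_nf z w)).
  by rewrite mulrA; apply: congrMr.
by rewrite -mulrA; apply: congrMl.
Qed.

(** Going from [p] to the first letter of [w] via [q] makes either no detour or
    one full turn; in the second case the factor [x ^+ 4] moves to the right. *)
Lemma word_nf_slide p q w m n :
  (m + quarter_turns p q + total_turns q w = n + total_turns p w)%N ->
  x ^+ quarter_turns p q * word_nf q w * x ^+ m ~~ word_nf p w * x ^+ n.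
Proof.
case: w => [|z w] /=.
  rewrite !addn0 mulr1 mul1r -exprD addnC => <-; exact: congr_refl.
have [cE|cE] : (quarter_turns p q + quarter_turns q z = quarter_turns p z \/
                quarter_turns p q + quarter_turns q z = quarter_turns p z + 4)%N.
- by case: p => [[] []]; case: q => [[] []]; case: z => [[] []]; solve [by left|by right].
- move=> mn; have -> : n = m by lia.
  rewrite mulrA -exprD cE; exact: congr_refl.
move=> mn; have -> : n = (4 + m)%N by lia.
rewrite mulrA -exprD cE !exprD.
move: (x ^+ 4) x4_y (@x4_word_nf z w) => x4 x4y x4w.
rewrite (mulrA _ x4 (x ^+ m)); apply: congrMr.
rewrite -!mulrA; apply: congrMl.
apply: (@congr_trans _ _ _ (y * x4 * word_nf z w)).
  by rewrite mulrA; apply: congrMr.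
by rewrite -mulrA; apply: congrMl.
Qed.

(** After multiplication by a, the reading direction before the first letter is
    one quarter turn too far; this is repaired by sliding. *)
Lemma nf_ga (g : G) : inS g -> x * nf g ~~ nf (ga * g)%g.
Proof.
case: g => u n /inSP /= le_un; rewrite gaM /nf.
rewrite [fst _]/= [snd _]/= [fst _]/= [snd _]/=.
rewrite -[word_nf letter_b u]word_nf_map_turn -alpha_word mulrA -{1}[x]expr1.
apply: (@word_nf_slide letter_b (turn letter_b)).
have := total_turns_alpha_le u.
rewrite [in total_turns (turn letter_b) _]alpha_word total_turns_map_turn.
change (quarter_turns letter_b (turn letter_b)) with 1%N.
by rewrite -[alpha_fun u]/(alpha u : F); lia.
Qed.

(** The only case that needs a relation is cancellation: then [word_nf] starts
    with [x ^+ 2 * y], and [y * x ^+ 2 * y] is congruent to [x ^+ 2]. *)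
Lemma nf_gb (g : G) : inS g -> y * nf g ~~ nf (gb * g)%g.
Proof.
case: g => u n /inSP /= le_un; rewrite gbM /nf.
rewrite [fst _]/= [snd _]/= [fst _]/= [snd _]/=.
have := total_turns_push_b u; rewrite -fb_word.
have:= fb_word u; case uE: (fg_word u) le_un => [|z w] /= le_un; last first.
  case: eqP => [zE|_] -> le_b.
    subst z; rewrite mulrA.
    change (quarter_turns letter_b (linv letter_b)) with 2%N.
    apply: (@congr_trans _ _ _ (x ^+ 2 * word_nf (linv letter_b) w *
      x ^+ absz (n - Posz (2 + total_turns (linv letter_b) w)))).
      apply: congrMr; move: (x ^+ 2) y_x2_y => x2 yx2y.
      by rewrite !mulrA; apply: congrMr.
    apply: (@word_nf_slide letter_b (linv letter_b)).
    move: le_un le_b; change (quarter_turns letter_b (linv letter_b)) with 2%N.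
    lia.
  by rewrite /= mul1r mulrA; apply: congr_refl.
by move=> -> /= _; rewrite /= !mul1r mulr1; apply: congr_refl.
Qed.

End NormalForms.

Section PresentationMap.
Local Open Scope ring_scope.
Variable K : comNzRingType.
Local Notation KS := (monoid_algebra K Smon).
Local Notation A := (free_algebra K 2).

Definition word_eval (u : fmonom 'I_2) : Smon :=
  (\prod_(i <- (u : seq 'I_2)) (if i == ord0 then sa else sb))%g.

Lemma word_evalM (u v : fmonom 'I_2) :
  word_eval (mmul u v) = mmul (word_eval u) (word_eval v).
Proof. by rewrite /word_eval fmM big_cat. Qed.

Lemma word_eval1 : word_eval mone = mone.
Proof. by rewrite /word_eval fm1 big_nil. Qed.

Definition monom_eval (u : fmonom 'I_2) : {malg K[Smon]} := << word_eval u >>.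

Lemma monomM (M : monomType) (m m' : M) :
  monom m * monom m' = monom (mmul m m') :> monoid_algebra K M.
Proof. by rewrite /monom [LHS]fgmulUU mulr1. Qed.

Lemma monom_eval_mmorphism : mmorphism monom_eval.
Proof.
split=> [u v|]; last by rewrite /monom_eval word_eval1.
rewrite /monom_eval word_evalM; apply: esym; exact: monomM.
Qed.

HB.instance Definition _ :=
  monalg.isMultiplicative.Build (fmonom 'I_2) {malg K[Smon]} monom_eval
    monom_eval_mmorphism.

Lemma malgC_comm (M : monomType) (c : K) (g : {malg K[M]}) : GRing.comm c%:MP g.
Proof.
rewrite /GRing.comm mul_malgC -{2}[g]mul1r.
have := @monoid_algebra_scaleAr K M c g 1; rewrite mulr1 => ->.
by rewrite -mul_malgC mulr1 mul1r.
Qed.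

Definition eval_map : A -> KS := mmap malgC monom_eval.

Fact eval_map_is_additive : additive eval_map.
Proof. exact: mmap_is_additive. Qed.

Fact eval_map_is_multiplicative : multiplicative eval_map.
Proof. by apply: commr_mmap_is_multiplicative => g m m'; apply: malgC_comm. Qed.

Fact eval_map_is_scalable : scalable eval_map.
Proof. by move=> c g; rewrite /eval_map mmapZ -[RHS]mul_malgC. Qed.

HB.instance Definition _ := GRing.isAdditive.Build A KS eval_map eval_map_is_additive.
HB.instance Definition _ :=
  GRing.isMultiplicative.Build A KS eval_map eval_map_is_multiplicative.
HB.instance Definition _ :=
  GRing.isScalable.Build K A KS *:%R eval_map eval_map_is_scalable.

Lemma eval_mapU (c : K) (u : fmonom 'I_2) :
  eval_map << c *g u >> = c *: monom (word_eval u).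
Proof. by rewrite /eval_map mmapU -[RHS]mul_malgC. Qed.

Lemma eval_map_var (i : 'I_2) :
  eval_map (fvar K i) = monom (if i == ord0 then sa else sb).
Proof.
rewrite [LHS](eval_mapU 1 (fmu i)) scale1r.
by rewrite /word_eval fmU big_seq1.
Qed.

Lemma monomX (s : Smon) n : (monom s : KS) ^+ n = monom (s ^+ n)%g.
Proof.
elim: n => [//|n IHn]; rewrite exprS IHn expgS; exact: monomM.
Qed.
End PresentationMap.
Arguments eval_map : clear implicits.

Section MorphismOnRelators.
Local Open Scope ring_scope.
Variables (R S : nzRingType) (f : {rmorphism R -> S}) (x y : R) (a b : S).
Hypotheses (fx : f x = a) (fy : f y = b).

Lemma morph_rel1 :
  b * a ^+ 2 * b = a ^+ 2 -> f (y * x ^+ 2 * y - x ^+ 2) = 0.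
Proof.
move=> abE; rewrite rmorphB (rmorphM f (y * x ^+ 2)) (rmorphM f y) !rmorphXn.
by rewrite fx fy abE subrr.
Qed.

Lemma morph_rel2 :
  a ^+ 4 * b = b * a ^+ 4 -> f (x ^+ 4 * y - y * x ^+ 4) = 0.
Proof.
move=> abE; rewrite rmorphB (rmorphM f (x ^+ 4)) (rmorphM f y) !rmorphXn.
by rewrite fx fy abE subrr.
Qed.
End MorphismOnRelators.

Section Relations.
Local Open Scope group_scope.

Lemma ga_gb : ga * gb = gc * ga.
Proof. by rewrite -ga_conj_b mulgVK. Qed.

Lemma ga_gc : ga * gc = gb^-1 * ga.
Proof. by rewrite -ga_conj_c mulgVK. Qed.

Lemma ga2_gb : ga ^+ 2 * gb = gb^-1 * ga ^+ 2.
Proof. by rewrite expgS expg1 -mulgA ga_gb mulgA ga_gc -mulgA. Qed.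

Lemma sb_sa2_sb : sb * sa ^+ 2 * sb = sa ^+ 2.
Proof.
apply: val_inj; rewrite !valM /=.
by rewrite -mulgA ga2_gb mulgA mulgV mul1g.
Qed.

Lemma sa4_sb : sa ^+ 4 * sb = sb * sa ^+ 4.
Proof.
rewrite -[4%N]/(2 + 2)%N expgnDr; move: (sa ^+ 2) sb_sa2_sb => t btb.
by rewrite -{1}btb -!mulgA [sb * (t * sb)]mulgA btb.
Qed.
End Relations.

Section Presented.
Local Open Scope ring_scope.
Variable K : comNzRingType.
Local Notation KS := (monoid_algebra K Smon).
Local Notation A := (free_algebra K 2).
Local Notation x := (fvar K ord0 : A).
Local Notation y := (fvar K ord_max : A).
Local Notation rels :=
  [:: (y * x ^+ 2 * y, x ^+ 2); (x ^+ 4 * y, y * x ^+ 4)].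
Local Notation rel_set :=
  (fun r : A => exists2 e : A * A, e \in rels & r = e.1 - e.2).
Local Notation "p ~~ q" := (congr_mod rel_set p q) (at level 70).

Lemma val_word_eval (u : fmonom 'I_2) :
  val (word_eval u) = (\prod_(i <- (u : seq 'I_2)) (if i == ord0 then ga else gb))%g.
Proof.
rewrite /word_eval; elim: (u : seq _) => [|i s IHs].
  by rewrite !big_nil val1.
by rewrite !big_cons valM IHs; case: ifP.
Qed.

Lemma monom_word_nf (u : fmonom 'I_2) :
  (monom u : A) ~~ nf x y (val (word_eval u)).
Proof.
have rel1 : y * x ^+ 2 * y ~~ x ^+ 2.
  by apply: IdealIn; exists (y * x ^+ 2 * y, x ^+ 2); rewrite ?mem_head.
have rel2 : x ^+ 4 * y ~~ y * x ^+ 4.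
  apply: IdealIn; exists (x ^+ 4 * y, y * x ^+ 4) => //.
  by rewrite in_cons; apply/orP; right; exact: mem_head.
case: u => s; elim: s => [|i s IHs].
  rewrite (_ : FMonom [::] = mone); last by apply: val_inj; rewrite /= fm1.
  rewrite word_eval1; have -> : nf x y (val (mone : Smon)) = 1 by apply: mul1r.
  exact: congr_refl.
rewrite (_ : FMonom (i :: s) = mmul (fmu i) (FMonom s)); last first.
  by apply: val_inj; rewrite /= fmM fmU.
rewrite -monomM word_evalM.
rewrite [val _](valM (word_eval (fmu i)) (word_eval (FMonom s))).
rewrite (val_word_eval (fmu i)) fmU big_seq1.
apply: (congr_trans (congrMl _ IHs)).
have : i = ord0 \/ i = ord_max.
  by case: i => [[|[|//]] lti]; [left|right]; apply: val_inj.
case=> -> /=.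
  exact: (nf_ga rel2 (valP _)).
exact: (nf_gb rel1 rel2 (valP _)).
Qed.

Lemma word_eval_surj (s : Smon) : exists u, word_eval u = s.
Proof.
case: s => g Sg.
suff [u uE] : exists u, val (word_eval u) = g by exists u; apply: val_inj.
have/asboolP := Sg; elim/submonoid_gen_ind_l => [|h g' hE [u uE]] {g Sg}.
  by exists mone; rewrite word_eval1.
have [i iE] : exists i : 'I_2, val (word_eval (fmu i)) = h.
  by case: hE => ->; [exists ord0|exists ord_max];
    rewrite val_word_eval fmU big_seq1.
by exists (mmul (fmu i) u); rewrite word_evalM -iE -uE; apply: valM.
Qed.

Lemma eval_map_surj (z : KS) : exists p, eval_map K p = z.
Proof.
rewrite [z]monalgE; elim/big_ind: _ => [|_ _ [p <-] [q <-]|s _].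
- by exists 0; rewrite raddf0.
- by exists (p + q); rewrite raddfD.
have [u <-] := word_eval_surj s; exists << z@_(word_eval u) *g u >>.
rewrite eval_mapU -mul_malgC; apply: etrans (fgmulUU _ _ _ _) _.
by rewrite mulr1 mul1m.
Qed.

Definition nf_section : KS -> A := mmap malgC (fun s : Smon => nf x y (val s)).

(** By linearity from the monomials.  As the section depends only on the value of
    [p], an element with value 0 is congruent to 0. *)
Lemma congr_nf_section (p : A) : p ~~ nf_section (eval_map K p).
Proof.
have secD : {morph nf_section : z z' / z + z'} by apply: mmapD.
have sec0 : nf_section 0 = 0 by apply: mmap0.
have evE : eval_map K p = \sum_(u <- msupp p) eval_map K << p@_u *g u >>.
  by rewrite -raddf_sum -monalgE.
rewrite evE (big_morph _ secD sec0) {1}[p]monalgE; apply: congr_sum => u.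
rewrite eval_mapU -mul_malgC /monom.
have -> : (p@_u)%:MP * << word_eval u >> = << p@_u *g word_eval u >> :> KS.
  by apply: etrans (fgmulUU _ _ _ _) _; rewrite mulr1 mul1m.
rewrite /nf_section mmapU.
have -> : << p@_u *g u >> = (p@_u)%:MP * monom u :> A.
  by apply: esym; apply: etrans (fgmulUU _ _ _ _) _; rewrite mulr1 mul1m.
by apply: congrMl; apply: monom_word_nf.
Qed.

Lemma eval_map_x : eval_map K x = monom sa.
Proof. by rewrite eval_map_var. Qed.

Lemma eval_map_y : eval_map K y = monom sb.
Proof. by rewrite eval_map_var. Qed.

Lemma presented_KS : presented_by [tuple monom sa : KS; monom sb] rels.
Proof.
exists (eval_map K); split.
- move=> i; apply: etrans (eval_map_var K i) _.
  have : i = ord0 \/ i = ord_max.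
    by case: i => [[|[|//]] lti]; [left|right]; apply: val_inj.
  by case=> ->.
- exact: eval_map_surj.
move=> p; rewrite -[GRing.LRMorphism.sort _ p]/(eval_map K p); split=> [p0|].
  have := congr_nf_section p; rewrite p0 /congr_mod.
  have -> : nf_section 0 = 0 by apply: mmap0.
  by rewrite subr0.
elim=> {p} [p [e]||p q _ p0 _ q0|r p _ p0|r p _ p0]; first last.
- by rewrite rmorphM /= p0 mul0r.
- by rewrite rmorphM /= p0 mulr0.
- by rewrite rmorphD /= p0 q0 addr0.
- exact: raddf0.
rewrite !inE => /orP[] /eqP -> ->.
  apply: (morph_rel1 eval_map_x eval_map_y).
  by rewrite monomX !monomM; congr monom; apply: sb_sa2_sb.
apply: (morph_rel2 eval_map_x eval_map_y).
rewrite monomX; move: (sa ^+ 4)%g sa4_sb => t tb.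
apply: etrans (monomM _ _ _) _; apply: etrans (esym (monomM _ _ _)).
by congr monom; apply: tb.
Qed.
End Presented.

(** * A right-invariant order on the free group and on G *)

Section FreeGroupOrder.
Local Open Scope ring_scope.
Local Notation letter := (bool * bool)%type.
Implicit Types (x y z : letter) (u v w : seq letter).

Definition letter_sign x : int := if x.2 then -1 else 1.

(** The sign of the turn at a vertex of the Cayley tree, where the four outgoing
    edges are ordered linearly by their phase; a word that arrives along [x]
    sees [linv x] behind it. *)
Definition corner x y : int :=
  ((phase x < phase y)%N : nat)%:Z - ((phase y < phase x)%N : nat)%:Z.

Definition last_letter u : option letter :=
  if u is x :: u' then Some (last x u') else None.

Definition joint u v : int :=
  match last_letter u, ohead v with
  | Some x, Some y => corner (linv x) y
  | _, _ => 0
  end.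

(** The total sign of the edges and corners on the path from 1 to [w] in the
    Cayley tree. *)
Fixpoint tau w : int :=
  if w is x :: w' then letter_sign x + joint [:: x] w' + tau w' else 0.

Definition winv w : seq letter := rev (map (@linv bool) w).

Lemma cornerN x y : corner y x = - corner x y.
Proof. by rewrite /corner opprB. Qed.

Lemma tau_cat u v : tau (u ++ v) = tau u + joint u v + tau v.
Proof.
elim: u => [|x u IHu]; first by rewrite /joint /= !add0r.
rewrite cat_cons /= IHu; case: u {IHu} => [|y u] /=; first by rewrite /joint /=; lia.
by rewrite /joint /=; case: (ohead v) => [z|]; lia.
Qed.

Lemma last_letter_winv u : last_letter (winv u) = omap (@linv bool) (ohead u).
Proof.
case: u => [//|x u]; rewrite /winv /= rev_cons.
by case: (rev _) => [//|z s] /=; rewrite last_rcons.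
Qed.

Lemma tau_winv u : tau (winv u) = - tau u.
Proof.
elim: u => [//|x u IHu].
have -> : winv (x :: u) = winv u ++ [:: linv x] by rewrite /winv /= rev_cons cats1.
rewrite tau_cat IHu /joint last_letter_winv /=.
have -> : letter_sign (linv x) = - letter_sign x by case: x => ? [].
case: u {IHu} => [|y u] /=; first by rewrite /joint /=; lia.
by rewrite /joint /= linvK cornerN; lia.
Qed.

(** There is one corner fewer than there are edges, and each edge or corner
    contributes 1 or -1. *)
Lemma tau_odd x w : reduced (x :: w) -> exists k : int, tau (x :: w) = k *+ 2 + 1.
Proof.
elim: w x => [|y w IHw] x red_w.
  by case: x {red_w} => i [] /=; [exists (-1)|exists 0].
have [k] := IHw y (reduced_behead red_w).
rewrite -[tau (x :: _)]/(letter_sign x + corner (linv x) y + tau (y :: w)) => ->.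
have: y != linv x by case/andP: red_w.
by case: x {red_w} => [[] []]; case: y {IHw} => [[] []] //= _;
  solve [by exists k; rewrite /letter_sign /corner /=; lia
        |by exists (k + 1); rewrite /letter_sign /corner /=; lia
        |by exists (k - 1); rewrite /letter_sign /corner /=; lia].
Qed.

(** The part [r] of [u] that cancels in the product of [u] and [w]. *)
Lemma cancel_decomp u w : reduced u -> reduced w ->
  exists g r h, [/\ u = g ++ r, w = winv r ++ h & foldr (@push bool) w u = g ++ h].
Proof.
elim: u => [|x u IHu] red_u red_w; first by exists [::], [::], w.
have [g [r [h [uE wE /= ->]]]] := IHu (reduced_behead red_u) red_w.
case: g uE => [|y g] /= uE.
  case: h wE => [|y h] /= wE; first by exists [:: x], r, [::]; rewrite uE.
  case: eqP => [yE|_]; last by exists [:: x], r, (y :: h); rewrite uE.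
  exists [::], (x :: r), h; split=> //=; first by rewrite uE.
  by rewrite wE yE /winv /= rev_cons cat_rcons.
exists (x :: y :: g), r, h; rewrite uE /=; split=> //.
by move: red_u; rewrite uE /reduced /= => /andP[/negbTE ->].
Qed.

(** The cancelled part contributes opposite amounts to [tau u] and [tau w], so that
    only the three corners where [g], [r] and [h] meet matter; their signs
    compare three edges in cyclic order, and add up to at most 1 in absolute value. *)
Lemma tau_mul u w : reduced u -> reduced w ->
  tau u + tau w - 1 <= tau (foldr (@push bool) w u).
Proof.
move=> red_u red_w; have [g [r [h [-> -> ->]]]] := cancel_decomp red_u red_w.
rewrite !tau_cat tau_winv /joint last_letter_winv.
case: (last_letter g) => [x|]; case: (ohead r) => [y|]; case: (ohead h) => [z|] /=;
  by rewrite ?linvK /corner; lia.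
Qed.

End FreeGroupOrder.

Section RightOrder.
Local Open Scope group_scope.

(** The exponent of a is compared first; on equal exponents the order is that of the
    free group, and [leG] is invariant under multiplication on the right. *)
Definition posG (g : G) : bool := (0 < g.2)%R || (g.2 == 0%R) && (0 < tau (fg_word g.1))%R.

Lemma tau_fgV (u : F) : tau (fg_word u^-1) = (- tau (fg_word u))%R.
Proof. exact: tau_winv. Qed.

Lemma tau_neq0 (u : F) : u != 1 -> tau (fg_word u) != 0%R.
Proof.
case: u => [[|x w] red_u] u_neq1; first by case/eqP: u_neq1; apply: val_inj.
by have [k] := tau_odd red_u; rewrite /= => ->; apply/eqP; lia.
Qed.

Lemma posGM g h : posG g -> posG h -> posG (g * h).
Proof.
case: g h => [u m] [v n]; rewrite /posG /=.
move=> /orP[m_gt0|/andP[/eqP -> u_gt0]] /orP[n_gt0|/andP[/eqP -> v_gt0]].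
- by rewrite addr_gt0.
- by rewrite addr0 m_gt0.
- by rewrite add0r n_gt0.
rewrite addr0 eqxx /=.
have := tau_mul (valP u) (valP v).
by move: u_gt0 v_gt0; rewrite /=; lia.
Qed.

Lemma posG_total g : g != 1 -> posG g || posG g^-1.
Proof.
case: g => u n g_neq1; case: (ltrgt0P n) g_neq1 => [n_gt0|n_lt0|->] g_neq1.
- by rewrite /posG /= n_gt0.
- by rewrite /posG /= oppr_gt0 n_lt0 orbT.
have /tau_neq0 : u != 1 by apply: contraNneq g_neq1 => ->.
have -> : ((u, 0%R) : G)^-1 = (u^-1, 0%R) by [].
by rewrite /posG /= tau_fgV oppr_gt0; lia.
Qed.

Lemma posG1 : posG 1 = false. Proof. by []. Qed.

Definition leG (g h : G) : bool := (g == h) || posG (h * g^-1).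

Lemma leG_trans : transitive leG.
Proof.
move=> h g k /orP[/eqP -> //|gh] /orP[/eqP <-|hk]; first by rewrite /leG gh orbT.
by rewrite /leG; have := posGM hk gh; rewrite mulgA mulgVK => ->; rewrite orbT.
Qed.

Lemma leG_total : total leG.
Proof.
move=> g h; rewrite /leG eq_sym; case: eqVneq => //= hg.
have /posG_total : h * g^-1 != 1 by rewrite -(inj_eq (mulIg g)) mulgVK mul1g.
by rewrite invgM invgK.
Qed.

Lemma leG_anti : antisymmetric leG.
Proof.
move=> g h /andP[/orP[/eqP //|gh] /orP[/eqP //|hg]].
by have := posGM gh hg; rewrite mulgA mulgVK mulgV posG1.
Qed.

Lemma leGM2r k g h : leG g h -> leG (g * k) (h * k).
Proof.
move=> /orP[/eqP ->|gh]; first by rewrite /leG eqxx.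
by rewrite /leG invgM mulgA mulgK gh orbT.
Qed.

Lemma leG_deg g h : leG g h -> (g.2 <= h.2)%R.
Proof.
move=> /orP[/eqP -> //|]; rewrite /posG /= => /orP[|/andP[/eqP]]; lia.
Qed.
End RightOrder.

(** * Monomials that arise only once in a product *)

Lemma exists_max (T : eqType) (r : rel T) (s : seq T) :
  transitive r -> total r -> s != [::] ->
  exists2 m, m \in s & {in s, forall t, r t m}.
Proof.
move=> r_trans r_total; elim: s => [//|x s IHs] _.
have rxx y : r y y by case/orP: (r_total y y).
case: (eqVneq s [::]) => [->|/IHs[m ms mP]].
  by exists x => [|t]; rewrite inE // => /eqP ->.
case/orP: (r_total x m) => [xm|mx].
  exists m => [|t]; first by rewrite inE ms orbT.
  by rewrite inE => /orP[/eqP -> //|/mP].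
exists x => [|t]; first by rewrite mem_head.
by rewrite inE => /orP[/eqP -> //|/mP tm]; apply: r_trans mx.
Qed.

Section UniqueProducts.
Local Open Scope ring_scope.
Variables (K : nzRingType) (M : monomType).
Implicit Types (x y : {malg K[M]}).

Lemma mcoeffM_unique x y (s t : M) :
  (forall s' t', s' \in msupp x -> t' \in msupp y ->
     mmul s' t' = mmul s t -> s' = s /\ t' = t) ->
  (x * y)@_(mmul s t) = x@_s * y@_t.
Proof.
move=> uniq_st; rewrite mcoeffMl.
have off s' t' : s' \in msupp x -> t' \in msupp y -> (s', t') != (s, t) ->
    (x@_s' * y@_t') *+ (mmul s' t' == mmul s t) = 0.
  move=> sx ty /eqP st; case: (mmul s' t' =P mmul s t) => [e|_]; last exact: mulr0n.
  by case: st; have [-> ->] := uniq_st _ _ sx ty e.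
case: (msuppP x s) => [sx|sNx]; last first.
  rewrite mul0r big_seq big1 // => s' s'x; rewrite big_seq big1 // => t' t'y.
  by apply: off => //; apply: contraNneq sNx => -[<- _].
rewrite (big_fsetD1 s) //= [X in _ + X]big_seq [X in _ + X]big1 ?addr0; last first.
  move=> s'; rewrite !inE => /andP[s'Ns s'x]; rewrite big_seq big1 // => t' t'y.
  by apply: off => //; apply: contraNneq s'Ns => -[-> _].
case: (msuppP y t) => [ty|tNy]; last first.
  rewrite mulr0 big_seq big1 // => t' t'y.
  by apply: off => //; apply: contraNneq tNy => -[<-].
rewrite (big_fsetD1 t) //= eqxx mulr1n [X in _ + X]big_seq [X in _ + X]big1 ?addr0 //.
move=> t'; rewrite !inE => /andP[t'Nt t'y]; apply: off => //.
by apply: contraNneq t'Nt => -[->].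
Qed.
End UniqueProducts.

(** * The anti-automorphism of S fixing a and b *)

Section Reversal.
Local Open Scope group_scope.

(** The restriction to the free group of the automorphism of G inverting both a
    and b; it fixes c, as a^-1 b^-1 a = c. *)
Definition eta : F -> F := fg_lift (fun i : bool => if i then fc else fb^-1).

Lemma etaM : {morph eta : u v / u * v}.
Proof. exact: fg_liftM. Qed.

Lemma eta1 : eta 1 = 1.
Proof. by apply: (mulgI (eta 1)); rewrite -etaM !mulg1. Qed.

Lemma eta_b : eta fb = fb^-1. Proof. exact: fg_lift_gen. Qed.
Lemma eta_c : eta fc = fc. Proof. exact: fg_lift_gen. Qed.

Lemma etaV : {morph eta : u / u^-1}.
Proof. exact: mulg_morphV etaM. Qed.

Lemma morph_F_eq (f g : F -> F) : {morph f : u v / u * v} ->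
  {morph g : u v / u * v} -> f fb = g fb -> f fc = g fc -> f =1 g.
Proof.
move=> fM gM fgb fgc u.
rewrite (fg_lift_uniq (f := fun i => g (fg_gen i)) fM); last by case.
by rewrite -(fg_lift_uniq (f := fun i => g (fg_gen i)) gM).
Qed.

Lemma etaK : involutive eta.
Proof.
apply: fg_endo_id => [u v||]; first by rewrite !etaM.
  by rewrite eta_b etaV eta_b invgK.
by rewrite !eta_c.
Qed.

Lemma alpha_inv_b : alpha_inv fb = fc^-1. Proof. exact: fg_lift_gen. Qed.
Lemma alpha_inv_c : alpha_inv fc = fb. Proof. exact: fg_lift_gen. Qed.

Lemma eta_alpha u : eta (alpha u) = alpha_inv (eta u).
Proof.
move: u; apply: (@morph_F_eq (eta \o alpha) (alpha_inv \o eta)) => [u v|u v||] /=.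
- by rewrite alpha_funM etaM.
- by rewrite etaM alpha_invM.
- by rewrite [alpha_fun _]alpha_b eta_c eta_b (mulg_morphV alpha_invM) alpha_inv_b invgK.
- by rewrite [alpha_fun _]alpha_c etaV eta_b eta_c alpha_inv_c invgK.
Qed.

Lemma eta_alpha_inv u : eta (alpha_inv u) = alpha (eta u).
Proof.
have := eta_alpha (alpha_inv u); rewrite [alpha _]alpha_invK => ->.
by rewrite [alpha _]alpha_invK.
Qed.

Lemma eta_zpow n u : eta (aut_zpow alpha n u) = aut_zpow alpha (- n)%R (eta u).
Proof.
case: n => n; last first.
  rewrite (_ : - Negz n = Posz n.+1)%R //.
  by rewrite /aut_zpow; elim: n.+1 => //= m IHm; rewrite eta_alpha_inv IHm.
have -> : (aut_zpow alpha (- Posz n)%R (eta u)) = iter n alpha_inv (eta u).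
  by case: n.
by rewrite /=; elim: n => //= n IHn; rewrite eta_alpha IHn.
Qed.

Definition inverse_gens (g : G) : G := (eta g.1, (- g.2)%R).

Lemma inverse_gensM : {morph inverse_gens : g h / g * h}.
Proof.
move=> [u m] [v n]; congr (_, _); first by rewrite /= etaM eta_zpow.
by rewrite /= opprD.
Qed.

(** Composed with inversion, the automorphism inverting a and b becomes an
    anti-automorphism fixing them. *)
Definition revG (g : G) : G := inverse_gens g^-1.

Lemma revGM g h : revG (g * h) = revG h * revG g.
Proof. by rewrite /revG invgM inverse_gensM. Qed.

Lemma inverse_gens1 : inverse_gens 1 = 1.
Proof. by apply: (mulgI (inverse_gens 1)); rewrite -inverse_gensM !mulg1. Qed.

Lemma inverse_gensV g : inverse_gens g^-1 = (inverse_gens g)^-1.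
Proof.
by apply: (mulgI (inverse_gens g)); rewrite -inverse_gensM !mulgV inverse_gens1.
Qed.

Lemma inverse_gensK : involutive inverse_gens.
Proof. by case=> u n; rewrite /inverse_gens /= etaK opprK. Qed.

Lemma revGK : involutive revG.
Proof. by move=> g; rewrite /revG -inverse_gensV inverse_gensK invgK. Qed.

Lemma revG_a : revG ga = ga.
Proof.
rewrite /revG inverse_gensV; apply: (can_inj invgK); rewrite invgK.
have -> : ga^-1 = inverse_gens ga :> G; last by [].
apply: (mulgI ga); rewrite mulgV; congr (_, _) => /=.
by rewrite mul1g eta1; symmetry; apply: (aut_zpow1 alpha 1%R).
Qed.

Lemma revG_b : revG gb = gb.
Proof.
rewrite /revG; congr (_, _); rewrite /= etaV.
by rewrite [eta _]eta_b invgK.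
Qed.

Lemma inS_rev g : inS g -> inS (revG g).
Proof.
move=> /asboolP; elim/submonoid_gen_ind_l => [|h k hE Sk].
  by rewrite /revG invg1 inverse_gens1; case: inS_closed.
rewrite revGM; apply: inS_closed.2 => //.
by case: hE => ->; rewrite ?revG_a ?revG_b; [exact: inS_ga|exact: inS_gb].
Qed.

Definition revS (s : Smon) : Smon := Sub (revG (val s)) (inS_rev (valP s)).

Lemma revSM s t : revS (s * t) = revS t * revS s.
Proof. by apply: val_inj; rewrite [RHS]valM -[LHS]/(revG (val (s * t))) valM revGM. Qed.

Lemma revSK : involutive revS.
Proof. by move=> s; apply: val_inj; rewrite /= revGK. Qed.

Lemma revS_a : revS sa = sa. Proof. by apply: val_inj; apply: revG_a. Qed.
Lemma revS_b : revS sb = sb. Proof. by apply: val_inj; apply: revG_b. Qed.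

Lemma revS1 : revS 1 = 1.
Proof.
by apply: val_inj; rewrite -[LHS]/(revG (val (1 : Smon))) val1 /revG invg1 inverse_gens1.
Qed.

Lemma revSX s n : revS (s ^+ n) = revS s ^+ n.
Proof. by elim: n => [|n IHn]; rewrite ?revS1 // expgSr revSM IHn -expgS. Qed.

End Reversal.

(** * Left divisibility by powers of b *)

Section Exponents.
Local Open Scope group_scope.

(** The signed number of leading letters b or b^-1; in a reduced word they all have
    the same sign. *)
Fixpoint lexp_word (w : seq (bool * bool)) : int :=
  match w with
  | (false, false) :: w' => (lexp_word w' + 1)%R
  | (false, true) :: w' => (lexp_word w' - 1)%R
  | _ => 0%R
  end.

Lemma lexp_word_push_b w : lexp_word (push letter_b w) = (lexp_word w + 1)%R.
Proof. by case: w => [|[[] []] w] //=; rewrite subrK. Qed.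

Lemma lexp_word_lt0 w : reduced w -> (lexp_word w < 0)%R ->
  exists w', w = linv letter_b :: w'.
Proof.
have lexp_b v : reduced (letter_b :: v) -> (0 < lexp_word (letter_b :: v))%R.
  elim: v => [//|[[] []] v IHv] // red_v.
  by have := IHv (reduced_behead red_v); rewrite /=; lia.
case: w => [//|[[] []] w] //; first by exists w.
by move=> /lexp_b /ltW; rewrite leNgt => /negbTE ->.
Qed.

Definition lexp (s : Smon) : int := lexp_word (fg_word (val s).1).

Definition sdeg (s : Smon) : nat := absz (val s).2.

Lemma sdegE (s : Smon) : Posz (sdeg s) = (val s).2.
Proof. by rewrite /sdeg; have [] := inS_deg (valP s); lia. Qed.

Lemma sdegM s t : sdeg (s * t) = (sdeg s + sdeg t)%N.
Proof.
suff : Posz (sdeg (s * t)) = (Posz (sdeg s) + Posz (sdeg t))%R by lia.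
by rewrite !sdegE valM.
Qed.

Lemma valX_Smon (s : Smon) n : val (s ^+ n) = val s ^+ n.
Proof. by elim: n => [|n IHn]; rewrite ?val1 // !expgS valM IHn. Qed.

Lemma Smon_mulgI (r s t : Smon) : r * s = r * t -> s = t.
Proof. by move=> /(congr1 val); rewrite !valM => /mulgI/val_inj. Qed.

Lemma lexp_bX n s : lexp (sb ^+ n * s) = (lexp s + Posz n)%R.
Proof.
elim: n => [|n IHn]; first by rewrite expg0 mul1g addr0.
rewrite expgS -mulgA /lexp valM.
case E: (val (sb ^+ n * s)) IHn => [u k] IHn.
rewrite [val sb * _](gbM u k) [fst _]/= fb_word lexp_word_push_b.
have -> : lexp_word (fg_word u) = lexp (sb ^+ n * s) by rewrite /lexp E.
by rewrite IHn -/(lexp s); lia.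
Qed.

Lemma sdeg_eq0 s : sdeg s = 0%N -> s = sb ^+ absz (lexp s).
Proof.
move=> s0; have [_ bP] := inS_deg (valP s).
have [|n sE] := bP; first by rewrite -sdegE s0.
have -> : s = sb ^+ n.
  apply: val_inj; rewrite valX_Smon gb_expE -sE -[RHS]/((val s).1, 0%R).
  have : (val s).2 = 0%R by rewrite -sdegE s0.
  by case: (val s) => u k /= ->.
by rewrite -[X in lexp X]mulg1 lexp_bX add0r.
Qed.

Lemma lexp_X_b n : lexp (sb ^+ n) = Posz n.
Proof. by rewrite -[X in lexp X]mulg1 lexp_bX add0r. Qed.

(** These are exactly the elements of S that are divisible on the left by every
    power of b, since a^2 = b^n a^2 b^n. *)
Definition b_divisible (s : Smon) : Prop :=
  exists N t, s = sb ^+ N * sa ^+ 2 * t.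

Lemma b_divisible_b s : b_divisible (sb * s) <-> b_divisible s.
Proof.
split=> [[[|N] [t tE]]|[N [t ->]]].
- exists 0%N, (sb * t); apply: (@Smon_mulgI sb).
  rewrite tE expg0 !mul1g; move: (sa ^+ 2) sb_sa2_sb => x bxb.
  by rewrite !mulgA bxb.
- exists N, t; apply: (@Smon_mulgI sb); rewrite tE (expgS _ N).
  by move: (sa ^+ 2) => x; rewrite !mulgA.
by exists N.+1, t; rewrite (expgS _ N); move: (sa ^+ 2) => x; rewrite !mulgA.
Qed.

Lemma b_divisible_bX n s : b_divisible (sb ^+ n * s) <-> b_divisible s.
Proof.
elim: n => [|n IHn]; first by rewrite mul1g.
by rewrite expgS -mulgA b_divisible_b.
Qed.

(** A word that starts with b^-1 has the two quarter turns before this letter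
    spelled out as a^2. *)
Lemma lexp_ge0 s : ~ b_divisible s -> (0 <= lexp s)%R.
Proof.
case: (leP 0%R (lexp s)) => // lexp_lt0 []; exists 0%N.
have [w' wE] := lexp_word_lt0 (valP (val s).1) lexp_lt0.
have le_s := inSP _ (valP s).
have [u sE [turnu _]] := peel_letter (val s).2 wE.
have Su : inS ((u, (val s).2 - 2%:Z)%R : G).
  have le2 : (Posz (2 + total_turns letter_b u)%N <= (val s).2)%R.
    by rewrite turnu; move: le_s; rewrite wE.
  by apply/inSP; move: le2; rewrite /=; lia.
exists (sb * Sub _ Su); apply: val_inj.
rewrite expg0 mul1g (valM (sa ^+ 2)) (valM sb) valX_Smon.
by apply: etrans _ sE; case: (val s).
Qed.

Lemma sb_sa2_sbX n : sb ^+ n * sa ^+ 2 * sb ^+ n = sa ^+ 2.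
Proof.
elim: n => [|n IHn]; first by rewrite mul1g mulg1.
rewrite {1}expgSr [sb ^+ n.+1]expgS; move: (sa ^+ 2) sb_sa2_sb IHn => t btb bntbn.
by rewrite !mulgA -(mulgA _ sb t) -(mulgA _ (sb * t) sb) btb.
Qed.

End Exponents.

(** * Zero divisors and degrees in K[S] *)

Section Algebra.
Local Open Scope ring_scope.
Variable K : fieldType.
Local Notation KS := (monoid_algebra K Smon).
Implicit Types (x y f g : KS) (s t : Smon).

Lemma msupp_neq0 x : x != 0 -> (msupp x : seq Smon) != [::].
Proof.
rewrite -msupp_eq0; apply: contraNneq => s0.
by rewrite -cardfs_eq0; apply/eqP; rewrite -[LHS]/(size (msupp x : seq _)) s0.
Qed.

(** Under a right-invariant order, the largest product with a given right factor
    uses the largest left factor [s]; the [t] for which [s * t] is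
    largest is then determined because [s] can be cancelled. *)
Lemma exists_lead x y : x != 0 -> y != 0 ->
  exists s t, [/\ s \in msupp x, t \in msupp y, (mmul s t) \in msupp (x * y),
    {in msupp x, forall s', (sdeg s' <= sdeg s)%N}
    & {in msupp y, forall t', (sdeg t' <= sdeg t)%N}].
Proof.
move=> /msupp_neq0 x_neq0 /msupp_neq0 y_neq0.
pose le (s t : Smon) := leG (val s) (val t).
have le_trans : transitive le by move=> ? ? ?; apply: leG_trans.
have le_total : total le by move=> ? ?; apply: leG_total.
have [s sx s_max] := exists_max le_trans le_total x_neq0.
(* The order is not left-invariant: [t] need not be the largest monomial of [y]. *)
pose le2 (t t' : Smon) := le (s * t)%g (s * t')%g.
have le2_trans : transitive le2 by move=> ? ? ?; apply: leG_trans.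
have le2_total : total le2 by move=> ? ?; apply: leG_total.
have [t ty t_max] := exists_max le2_trans le2_total y_neq0.
exists s, t; split=> //.
- rewrite -mcoeff_neq0 mcoeffM_unique ?mulf_neq0 ?mcoeff_neq0 // => s' t' s'x t'y e.
  have le1 : leG (val s' * val t')%g (val s * val t')%g by apply/leGM2r/s_max.
  have := t_max _ t'y; rewrite /le2 /le !valM => le2'.
  have e' : (val s' * val t' = val s * val t)%g.
    by have := congr1 val e; rewrite !valM.
  have/val_inj tt' : val t' = val t.
    apply: (mulgI (val s)); apply: leG_anti; rewrite le2' -e' le1 //.
  split=> //; apply: val_inj; apply: (mulIg (val t)).
  by rewrite -{1}tt'.
- move=> s' /s_max /leG_deg; rewrite -!sdegE; lia.
move=> t' /t_max /leG_deg; rewrite -!sdegE !sdegM; lia.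
Qed.

Lemma KS_mulf_neq0 x y : x != 0 -> y != 0 -> x * y != 0.
Proof.
move=> x0 y0; have [s [t [_ _ st _ _]]] := exists_lead x0 y0.
by apply: contraTneq st => ->; rewrite msupp0 inE.
Qed.

Lemma KS_domain : is_domain KS.
Proof.
move=> x y xy0; case: (eqVneq x 0) => [|x0]; first by left.
case: (eqVneq y 0) => [|y0]; first by right.
by have := KS_mulf_neq0 x0 y0; rewrite xy0 eqxx.
Qed.

Definition adeg x : nat := (\max_(s <- msupp x) sdeg s)%N.

Lemma sdeg_le_adeg x s : s \in msupp x -> (sdeg s <= adeg x)%N.
Proof. by move=> sx; rewrite /adeg (big_fsetD1 s) //= leq_maxl. Qed.

Lemma bigmax_leq_seq (I : eqType) (r : seq I) (h : I -> nat) n :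
  {in r, forall i, (h i <= n)%N} -> (\max_(i <- r) h i <= n)%N.
Proof.
move=> hn; rewrite big_seq; elim/big_ind: _ => // i j.
by rewrite geq_max => -> ->.
Qed.

Lemma adegM_ge x y : x != 0 -> y != 0 -> (adeg x + adeg y <= adeg (x * y)%R)%N.
Proof.
move=> x0 y0; have [s [t [_ _ st sx ty]]] := exists_lead x0 y0.
apply: leq_trans (sdeg_le_adeg st); rewrite [sdeg _]sdegM.
by apply: leq_add; apply: bigmax_leq_seq.
Qed.

(** Used for elements of a-degree 0, where it is the degree as a polynomial in b, and
    as a bound in [bdeg_left_factor]. *)
Definition bdeg f : nat := (\max_(s <- msupp f) absz (lexp s))%N.

Lemma adeg0P f s : adeg f = 0%N -> s \in msupp f -> s = (sb ^+ absz (lexp s))%g.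
Proof. by move=> f0 /sdeg_le_adeg; rewrite f0 leqn0 => /eqP/sdeg_eq0. Qed.

Lemma bdeg_ge f s : s \in msupp f -> (absz (lexp s) <= bdeg f)%N.
Proof. by move=> sx; rewrite /bdeg (big_fsetD1 s) //= leq_maxl. Qed.

Lemma bdeg_msupp f : adeg f = 0%N -> f != 0 -> (sb ^+ bdeg f)%g \in msupp f.
Proof.
move=> f0 /msupp_neq0 fn0.
have [||s sf s_max] := @exists_max _ (relpre (fun s => absz (lexp s)) leq) _ _ _ fn0.
- by move=> ? ? ?; apply: leq_trans.
- by move=> ? ?; apply: leq_total.
suff -> : bdeg f = absz (lexp s) by rewrite -(adeg0P f0).
by apply/eqP; rewrite eqn_leq bdeg_ge // andbT; apply: bigmax_leq_seq.
Qed.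

(** Among the monomials of [y] satisfying [P], take one with the most leading b;
    multiplied by the top term of [f] it cannot be cancelled.  The predicate
    selects a union of orbits under multiplication by b. *)
Lemma msupp_top (P : Smon -> Prop) f y t0 :
  (forall n s, P (sb ^+ n * s)%g <-> P s) ->
  adeg f = 0%N -> f != 0 -> t0 \in msupp y -> P t0 ->
  exists t, [/\ t \in msupp y, P t,
    (forall t', t' \in msupp y -> P t' -> lexp t' <= lexp t)
    & (sb ^+ bdeg f * t)%g \in msupp (f * y)].
Proof.
move=> P_shift f0 fn0 t0y Pt0.
pose r := [seq t <- msupp y | `[< P t >]].
have rn0 : r != [::].
  have : t0 \in r by rewrite mem_filter t0y andbT; apply/asboolP.
  by case: (r).
have [||t] := @exists_max _ (relpre lexp <=%R) r _ _ rn0.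
- by move=> ? ? ?; apply: le_trans.
- by move=> ? ?; apply: le_total.
rewrite mem_filter => /andP[/asboolP Pt ty] t_max0.
have t_max t' : t' \in msupp y -> P t' -> lexp t' <= lexp t.
  by move=> t'y Pt'; apply: t_max0; rewrite mem_filter t'y andbT; apply/asboolP.
exists t; split=> //; rewrite -mcoeff_neq0.
have := @mcoeffM_unique _ _ f y (sb ^+ bdeg f)%g t.
rewrite [mmul _ t]/((sb ^+ bdeg f) * t)%g => ->.
  by rewrite mulf_neq0 ?mcoeff_neq0 ?bdeg_msupp.
move=> s t' sf t'y e0; have e : (s * t' = sb ^+ bdeg f * t)%g := e0.
have sE := adeg0P f0 sf; have le_s := bdeg_ge sf.
rewrite sE in e.
have Pt' : P t' by apply/(P_shift (absz (lexp s))); rewrite e; apply/P_shift.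
have := t_max _ t'y Pt'.
have := congr1 lexp e; rewrite !lexp_bX => eL le_t.
(* [lexp s] is at most [bdeg f] and [lexp t'] at most [lexp t], but the sums agree. *)
have sN : absz (lexp s) = bdeg f by lia.
rewrite sE sN; split=> //.
by apply: (@Smon_mulgI (sb ^+ bdeg f)%g); rewrite -e sN.
Qed.

Lemma bdegM_ge f g : adeg f = 0%N -> adeg g = 0%N -> f != 0 -> g != 0 ->
  (bdeg f + bdeg g <= bdeg (f * g)%R)%N.
Proof.
move=> f0 g0 fn0 gn0; have gt := bdeg_msupp g0 gn0.
have [//|t [tg _ t_max tfg]] := @msupp_top (fun _ => True) f g _ _ f0 fn0 gt I.
apply: leq_trans (bdeg_ge tfg); rewrite lexp_bX.
have := t_max _ gt I; rewrite lexp_X_b; lia.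
Qed.

(** The property of not being [b_divisible] passes from the monomials of [f * z]
    to those of [z], where it makes the number of leading b nonnegative;
    multiplication by the top term of [f] raises this number by [bdeg f]. *)
Lemma bdeg_left_factor f z s : s \in msupp (f * z) -> ~ b_divisible s ->
  adeg f = 0%N -> (bdeg f <= bdeg (f * z)%R)%N.
Proof.
move=> sfz sN f0.
have fn0 : f != 0 by apply: contraTneq sfz => ->; rewrite mul0r msupp0 inE.
have [t0 t0z t0N] : exists2 t0, t0 \in msupp z & ~ b_divisible t0.
  have /msuppM_le[s1 [t0 [s1f t0z sE]]] := sfz.
  exists t0 => //; move: sN; rewrite sE (adeg0P f0 s1f).
  by rewrite [mmul _ _]/((_ ^+ _) * t0)%g b_divisible_bX.
have [|t [_ tN _ tfz]] := @msupp_top (fun s => ~ b_divisible s) f z _ _ f0 fn0 t0z t0N.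
  by move=> n s'; rewrite b_divisible_bX.
apply: leq_trans (bdeg_ge tfz); rewrite lexp_bX.
have := lexp_ge0 tN; lia.
Qed.

End Algebra.

(** * The anti-automorphism of K[S] *)

Section Antimorphism.
Local Open Scope ring_scope.
Variables (R S : nzRingType) (f : R -> S).
Hypothesis fD : forall x y, f (x + y) = f x + f y.

Lemma antimorphDl x x' y : f (x * y) = f y * f x -> f (x' * y) = f y * f x' ->
  f ((x + x') * y) = f y * f (x + x').
Proof. by move=> fxy fx'y; rewrite mulrDl !fD fxy fx'y mulrDr. Qed.

Lemma antimorphDr x y y' : f (x * y) = f y * f x -> f (x * y') = f y' * f x ->
  f (x * (y + y')) = f (y + y') * f x.
Proof. by move=> fxy fxy'; rewrite mulrDr !fD fxy fxy' mulrDl. Qed.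
End Antimorphism.

Section ReversalAlgebra.
Local Open Scope ring_scope.
Variable K : fieldType.
Local Notation KS := (monoid_algebra K Smon).
Implicit Types (x y z f g : KS) (s t : Smon) (c : K).

Lemma malg_ind (P : KS -> Prop) : P 0 -> (forall x y, P x -> P y -> P (x + y)) ->
  (forall c s, P << c *g s >>) -> forall x, P x.
Proof. by move=> P0 PD PU x; rewrite [x]monalgE; elim/big_ind: _. Qed.

Definition rev_alg : KS -> KS := mmap malgC (fun s => << revS s >>).

Lemma mulUU c d s t : << c *g s >> * << d *g t >> = << c * d *g (s * t)%g >> :> KS.
Proof. exact: fgmulUU. Qed.

Lemma rev_algU c s : rev_alg << c *g s >> = << c *g revS s >>.
Proof.
rewrite /rev_alg mmapU; apply: etrans (fgmulUU _ _ _ _) _.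
by rewrite mulr1 mul1m.
Qed.

Lemma rev_algD x y : rev_alg (x + y) = rev_alg x + rev_alg y.
Proof. exact: mmapD. Qed.

Lemma rev_alg0 : rev_alg 0 = 0.
Proof. exact: mmap0. Qed.

Lemma rev_algM x y : rev_alg (x * y) = rev_alg y * rev_alg x.
Proof.
elim/malg_ind: x => [|x x' IHx IHx'|c s].
- by rewrite mul0r rev_alg0 mulr0.
- exact (@antimorphDl KS KS rev_alg rev_algD x x' y IHx IHx').
elim/malg_ind: y => [|y y' IHy IHy'|d t].
- by rewrite mulr0 rev_alg0 mul0r.
- exact (@antimorphDr KS KS rev_alg rev_algD _ y y' IHy IHy').
by rewrite mulUU !rev_algU mulUU revSM mulrC.
Qed.

Lemma rev_algK : involutive rev_alg.
Proof.
move=> x; elim/malg_ind: x => [|x y IHx IHy|c s].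
- by rewrite !rev_alg0.
- exact (etrans (congr1 rev_alg (rev_algD x y)) (etrans (rev_algD _ _) (congr2 +%R IHx IHy))).
by rewrite !rev_algU revSK.
Qed.

Lemma rev_alg_adeg0 f : adeg f = 0%N -> rev_alg f = f.
Proof.
move=> f0; rewrite {1}[f]monalgE (big_morph _ rev_algD rev_alg0) [RHS]monalgE.
rewrite big_seq [RHS]big_seq; apply: eq_bigr => s sf.
by rewrite rev_algU (adeg0P f0 sf) revSX revS_b.
Qed.

Lemma rev_alg_neq0 x : x != 0 -> rev_alg x != 0.
Proof. by apply: contraNneq => x0; rewrite -[x]rev_algK x0 rev_alg0. Qed.

Lemma rev_alg_monom s : rev_alg (monom s) = monom (revS s).
Proof. exact: rev_algU. Qed.
End ReversalAlgebra.

(** * Atomicity *)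

Lemma mulr_interchange (R : nzRingType) (a b c d : R) :
  (c * b = b * c)%R -> (a * b * (c * d) = a * c * (b * d))%R.
Proof. by move=> cb; rewrite !mulrA -(mulrA a b) -cb !mulrA. Qed.

Section UnitMultiples.
Local Open Scope ring_scope.
Variable R : nzRingType.
Implicit Types x y u : R.

Lemma is_unitM x y : is_unit x -> is_unit y -> is_unit (x * y).
Proof.
move=> [x' [xx' x'x]] [y' [yy' y'y]]; exists (y' * x').
by rewrite !mulrA -(mulrA x) yy' mulr1 -(mulrA y') x'x mulr1.
Qed.

Lemma is_atom_unitM x u : is_unit x -> is_atom u -> is_atom (x * u).
Proof.
move=> ux; have [x' [xx' x'x]] := ux; have ux' : is_unit x' by exists x.
move=> [u0 u_nu u_fac]; split.
- by move=> xu0; apply: u0; rewrite -[u]mul1r -x'x -mulrA xu0 mulr0.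
- by move=> /(is_unitM ux'); rewrite mulrA x'x mul1r.
move=> y z y0 z0 e; have [||y_u|] := u_fac (x' * y) z _ z0.
- by move=> x'y0; apply: y0; rewrite -[y]mul1r -xx' -mulrA x'y0 mulr0.
- by rewrite -mulrA -e mulrA x'x mul1r.
- by left; rewrite -[y]mul1r -xx' -mulrA; apply: is_unitM.
by right.
Qed.
Lemma prod_cons_scale x u (r : seq R) :
  x * \prod_(v <- u :: r) v = \prod_(v <- x * u :: r) v.
Proof. by rewrite !big_cons mulrA. Qed.
Lemma add_common_left_factor (a b c d e x y : R) : a = c * d -> b = c * e ->
  a * x + b * y = c * (d * x + e * y).
Proof. by move=> -> ->; rewrite mulrDr !mulrA. Qed.
Lemma mulr_regroup (a b c d : R) :
  a * (b * c) * d = a * b * (c * d) /\ a * (b * c) * d = a * b * c * d.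
Proof. by rewrite !mulrA. Qed.
End UnitMultiples.

Section Atomicity.
Local Open Scope ring_scope.
Variable K : fieldType.
Local Notation KS := (monoid_algebra K Smon).
Implicit Types (x y z f g u v : KS) (s t : Smon) (c d : K).

Lemma msupp_monom s : msupp (monom s : KS) = [fset s]%fset.
Proof. exact: msuppU1. Qed.

Lemma adeg_monom s : adeg (monom s : KS) = sdeg s.
Proof. by rewrite /adeg msupp_monom big_seq_fset1. Qed.

Lemma bdeg_monom s : bdeg (monom s : KS) = absz (lexp s).
Proof. by rewrite /bdeg msupp_monom big_seq_fset1. Qed.

Lemma monom_neq0 s : (monom s : KS) != 0.
Proof. by rewrite /monom monalgU_eq0 oner_neq0. Qed.

Lemma malgC_mul c d : c%:MP * d%:MP = (c * d)%:MP :> KS.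
Proof. by apply: esym; apply: mpolyCM. Qed.

Lemma is_unitC c : c != 0 -> is_unit (c%:MP : KS).
Proof.
move=> c0; exists (c^-1)%:MP; split; rewrite malgC_mul.
  by rewrite divff.
by rewrite mulVf.
Qed.

Lemma is_unit_neq0 x : is_unit x -> x != 0.
Proof.
by move=> [y [xy _]]; apply: contra_eq_neq xy => ->; rewrite mul0r eq_sym oner_neq0.
Qed.

Lemma degs0_scalar f : adeg f = 0%N -> bdeg f = 0%N -> f != 0 ->
  exists2 c, c != 0 & f = c%:MP.
Proof.
move=> f0 b0 fn0; have fE : f = (f@_(1%g : Smon))%:MP.
  apply/malgP => s; rewrite mcoeffC; case: eqVneq => [->|s1] //=.
  apply/mcoeff_outdom; apply: contraNN s1 => sf.
  have := bdeg_ge sf; rewrite b0 leqn0 => /eqP l0.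
  by rewrite (adeg0P f0 sf) l0.
exists (f@_(1%g : Smon)) => //; apply: contraNneq fn0 => c0.
by rewrite fE c0 malgC0E.
Qed.

Lemma adeg1 : adeg (1 : KS) = 0%N. Proof. by rewrite [LHS](adeg_monom 1%g). Qed.
Lemma bdeg1 : bdeg (1 : KS) = 0%N. Proof. by rewrite [LHS](bdeg_monom 1%g). Qed.

Lemma mul_eq1_degs x y : x * y = 1 ->
  [/\ adeg x = 0%N, adeg y = 0%N, bdeg x = 0%N & bdeg y = 0%N].
Proof.
move=> xy1; have xyn0 : x * y != 0 by rewrite xy1 oner_neq0.
have xn0 : x != 0 by apply: contraNneq xyn0 => ->; rewrite mul0r.
have yn0 : y != 0 by apply: contraNneq xyn0 => ->; rewrite mulr0.
have := adegM_ge xn0 yn0; rewrite xy1 adeg1 leqn0 addn_eq0 => /andP[/eqP ax /eqP ay].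
have := bdegM_ge ax ay xn0 yn0; rewrite xy1 bdeg1 leqn0 addn_eq0.
by move=> /andP[/eqP bx /eqP by_].
Qed.

Lemma is_unitP x : is_unit x <-> [/\ adeg x = 0%N, bdeg x = 0%N & x != 0].
Proof.
split=> [ux|[ax bx x0]]; last first.
  by have [c c0 ->] := degs0_scalar ax bx x0; apply: is_unitC.
have xn0 := is_unit_neq0 ux; have [y [/mul_eq1_degs[ax _ bx _] _]] := ux.
by split.
Qed.

(** Allowing a scalar factor makes this property multiplicative and true for
    units. *)
Definition factors x : Prop :=
  exists c (r : seq KS), [/\ c != 0, forall u, u \in r -> is_atom u
    & x = c%:MP * \prod_(u <- r) u].

Lemma factors_mul x y : factors x -> factors y -> factors (x * y).
Proof.
move=> [c [r [c0 r_at ->]]] [d [q [d0 q_at ->]]].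
exists (c * d), (r ++ q); split; first exact: mulf_neq0.
  by move=> u; rewrite mem_cat => /orP[/r_at|/q_at].
rewrite big_cat -malgC_mul; apply: mulr_interchange.
exact: malgC_comm.
Qed.

Lemma factors_unit x : is_unit x -> factors x.
Proof.
move=> /is_unitP[ax bx xn0]; have [c c0 ->] := degs0_scalar ax bx xn0.
by exists c, [::]; split=> //; rewrite big_nil mulr1.
Qed.

Lemma factors_atom x : is_atom x -> factors x.
Proof.
move=> x_at; exists 1, [:: x]; split; first exact: oner_neq0.
  by move=> u; rewrite inE => /eqP ->.
by rewrite big_seq1 mpolyC1E mul1r.
Qed.

Lemma atom_scale c u : c != 0 -> is_atom u -> is_atom (c%:MP * u).
Proof. by move=> /is_unitC; apply: is_atom_unitM. Qed.

Lemma factors_prod x : factors x -> ~ is_unit x ->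
  exists2 r : seq KS, forall u, u \in r -> is_atom u & x = \prod_(u <- r) u.
Proof.
move=> [c [[|u r] [c0 r_at xE]]] x_nu.
  by case: x_nu; rewrite xE big_nil mulr1; apply: is_unitC.
exists (c%:MP * u :: r); last by rewrite xE; apply: prod_cons_scale.
move=> v; rewrite inE => /orP[/eqP ->|vr]; last by apply: r_at; rewrite inE vr orbT.
by apply: atom_scale; [exact: c0|apply: r_at; exact: mem_head].
Qed.

Lemma factors_or_split x : x != 0 ->
  factors x \/ exists u v, [/\ x = u * v, u != 0, v != 0, ~ is_unit u & ~ is_unit v].
Proof.
move=> x0; case: (EM (is_unit x)) => [/factors_unit|x_nu]; first by left.
case: (EM (is_atom x)) => [/factors_atom|x_na]; first by left.
right; apply: contrapT => no_split; apply: x_na; split=> //; first exact/eqP.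
move=> u v /eqP u0 /eqP v0 xE; apply: contrapT => /not_orP[nu nv].
apply: no_split; exists u, v; split; [exact: xE|exact: u0|exact: v0|exact: nu|exact: nv].
Qed.

Lemma factors_adeg0 f : adeg f = 0%N -> f != 0 -> factors f.
Proof.
elim/ltn_ind: (bdeg f) {-2}f (erefl (bdeg f)) => n IHn {}f fn f0 fn0.
have [//|[u [v [fE u0 v0 nu nv]]]] := factors_or_split fn0.
have := adegM_ge u0 v0; rewrite -fE f0 leqn0 addn_eq0 => /andP[/eqP au /eqP av].
have bu : (0 < bdeg u)%N by rewrite lt0n; apply/eqP => bu; apply/nu/is_unitP.
have bv : (0 < bdeg v)%N by rewrite lt0n; apply/eqP => bv; apply/nv/is_unitP.
have := bdegM_ge au av u0 v0; rewrite -fE fn => le_n.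
by rewrite fE; apply: factors_mul; [apply: (IHn (bdeg u))|apply: (IHn (bdeg v))] => //; lia.
Qed.

Lemma sdeg_a : sdeg sa = 1%N. Proof. by []. Qed.
Lemma sdeg_a2 : sdeg (sa ^+ 2)%g = 2%N. Proof. by rewrite expgS sdegM. Qed.
Lemma lexp_a : lexp sa = 0. Proof. by []. Qed.

Lemma a_not_b_divisible : ~ b_divisible sa.
Proof.
move=> [N [t /(congr1 sdeg)]].
by rewrite (sdegM _ t) (sdegM _ (sa ^+ 2)%g) sdeg_a2 sdeg_a; lia.
Qed.

(** The element a has a-degree 1, is not [b_divisible] and has no leading b, so that
    a left factor which is a polynomial in b is constant; reversal gives the
    same for right factors. *)
Lemma atom_a : is_atom (monom sa : KS).
Proof.
have a_nl : forall u v, monom sa = u * v :> KS -> adeg u = 0%N -> is_unit u.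
  move=> u v aE au; have u0 : u != 0.
    by apply: contraTneq (monom_neq0 sa) => u0; rewrite aE u0 mul0r eqxx.
  apply/is_unitP; split=> //; apply/eqP; rewrite -leqn0.
  have := @bdeg_left_factor K u v sa; rewrite -aE bdeg_monom lexp_a; apply=> //.
    by rewrite msupp_monom inE.
  exact: a_not_b_divisible.
split; first exact/eqP/monom_neq0.
  by move=> /is_unitP[]; rewrite adeg_monom.
move=> u v /eqP u0 /eqP v0 aE.
have := adegM_ge u0 v0; rewrite -aE adeg_monom sdeg_a.
case: (posnP (adeg u)) => [/(a_nl _ _ aE)|au]; first by left.
case: (posnP (adeg v)) => [av _|av]; last by lia.
right; rewrite -(rev_alg_adeg0 av); apply: (a_nl _ (rev_alg u)).
  by rewrite -rev_algM -aE rev_alg_monom revS_a.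
by rewrite rev_alg_adeg0.
Qed.

Lemma lexp_b : lexp sb = 1. Proof. by []. Qed.

Lemma atom_b : is_atom (monom sb : KS).
Proof.
split; first exact/eqP/monom_neq0.
  by move=> /is_unitP[]; rewrite bdeg_monom lexp_b.
move=> u v /eqP u0 /eqP v0 bE.
have := adegM_ge u0 v0; rewrite -bE adeg_monom leqn0 addn_eq0 => /andP[/eqP au /eqP av].
have := bdegM_ge au av u0 v0; rewrite -bE bdeg_monom lexp_b.
case: (posnP (bdeg u)) => [bu|bu]; first by left; apply/is_unitP.
case: (posnP (bdeg v)) => [bv|bv]; first by right; apply/is_unitP.
by rewrite /=; lia.
Qed.

Lemma monomM_Smon s t : (monom s : KS) * monom t = monom (s * t)%g.
Proof. exact: monomM. Qed.

Lemma factors_monomX s n : is_atom (monom s : KS) -> factors (monom (s ^+ n)%g).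
Proof.
move=> s_at; elim: n => [|n IHn]; last first.
  by rewrite expgS -monomM_Smon; apply: factors_mul IHn; apply: factors_atom.
by rewrite -[monom _]/(1 : KS); apply: factors_unit; exists 1; rewrite !mulr1.
Qed.

(** Since b^N a^2 = b^(N+M) a^2 b^M, the exponent N can be chosen uniformly for
    the finitely many monomials. *)
Lemma b_divisible_factor y : (forall s, s \in msupp y -> b_divisible s) ->
  exists N z, y = monom (sb ^+ N * sa ^+ 2)%g * z.
Proof.
move=> y_ld; have shift N M : monom (sb ^+ N * sa ^+ 2)%g =
    monom (sb ^+ (N + M) * sa ^+ 2)%g * monom (sb ^+ M)%g :> KS.
  rewrite monomM_Smon expgnDr; congr monom.
  move: (sa ^+ 2)%g (sb_sa2_sbX M) => t tE.
  by rewrite -{1}tE !mulgA.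
rewrite [y]monalgE big_seq; elim/big_ind: _ => [|_ _ [N [z ->]] [M [w ->]]|s /y_ld[N [t ->]]].
- by exists 0%N, 0; rewrite mulr0.
- exists (N + M)%N, (monom (sb ^+ M)%g * z + monom (sb ^+ N)%g * w).
  apply: add_common_left_factor; first exact: shift.
  by rewrite addnC; apply: shift.
exists N, << y@_(sb ^+ N * sa ^+ 2 * t)%g *g t >>.
by rewrite mulUU mul1r.
Qed.

(** The statement includes [rev_alg u] so that it can also be applied to the
    reversal of an element. *)
Lemma factors_b_divisible y : y != 0 ->
  (forall s, s \in msupp y -> b_divisible s) ->
  exists u z, [/\ y = u * z, factors u, factors (rev_alg u) & (0 < adeg u)%N].
Proof.
move=> y0 /b_divisible_factor[N [z yE]].
exists (monom (sb ^+ N * sa ^+ 2)%g), z; split=> //.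
- rewrite -monomM_Smon; apply: factors_mul; apply: factors_monomX.
    exact: atom_b.
  exact: atom_a.
- rewrite rev_alg_monom revSM !revSX revS_a revS_b -monomM_Smon.
  apply: factors_mul; apply: factors_monomX; [exact: atom_a|exact: atom_b].
by rewrite adeg_monom sdegM sdeg_a2 addnC.
Qed.

Lemma fuel_decr (a b c d e m : nat) :
  (e < a + d + m.+1 -> a + b <= c -> 0 < b -> e < c + d + m)%N.
Proof. lia. Qed.

(** Both [s1] and [s2] bound the degree of the polynomials in b that can be split
    off from [x] on the left and on the right.  The induction is on the distance
    to the bound: if the middle factor splits as [u * v], then [u] or [v] is a
    polynomial in b and can be moved to [f] or [g]. *)
Lemma factors_indecomposable x s1 s2 : x != 0 ->
  (forall u v, x = u * v -> adeg u = 0%N \/ adeg v = 0%N) ->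
  s1 \in msupp x -> ~ b_divisible s1 ->
  s2 \in msupp (rev_alg x) -> ~ b_divisible s2 -> factors x.
Proof.
move=> x0 indec s1x s1N s2x s2N.
(* Here [m] is more than the sum of the two degrees that can still be split off. *)
suff core m f y g : x = f * y * g -> adeg f = 0%N -> adeg g = 0%N ->
    (bdeg x + bdeg (rev_alg x) < bdeg f + bdeg g + m)%N -> factors y.
  apply: (core (bdeg x + bdeg (rev_alg x)).+1 1 x 1).
  - by rewrite mulr1 mul1r.
  - exact: adeg1.
  - exact: adeg1.
  by rewrite bdeg1.
elim: m f y g => [|m IHm] f y g xE f0 g0 lt_m.
  have le_f : (bdeg f <= bdeg x)%N.
    have xE' : x = f * (y * g) by rewrite xE mulrA.
    by have := @bdeg_left_factor K f (y * g) s1; rewrite -xE'; apply.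
  have le_g : (bdeg g <= bdeg (rev_alg x))%N.
    have xE' : rev_alg x = g * rev_alg (f * y).
      exact (etrans (congr1 (@rev_alg K) xE) (etrans (rev_algM (f * y) g)
        (congr1 (fun z => z * rev_alg (f * y)) (rev_alg_adeg0 g0)))).
    by have := @bdeg_left_factor K g (rev_alg (f * y)) s2; rewrite -xE'; apply.
  by exfalso; move: lt_m le_f le_g; lia.
have fyg0 : f * y * g != 0 by rewrite -xE.
have fy0 : f * y != 0 by apply: contraNneq fyg0 => e; rewrite e mul0r.
have f_neq0 : f != 0 by apply: contraNneq fy0 => e; rewrite e mul0r.
have y_neq0 : y != 0 by apply: contraNneq fy0 => e; rewrite e mulr0.
have g_neq0 : g != 0 by apply: contraNneq fyg0 => e; rewrite e mulr0.
have [//|[u [v [yE u0 v0 nu nv]]]] := factors_or_split y_neq0.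
have [xE1 xE2] : x = (f * u) * (v * g) /\ x = (f * u) * v * g.
  by rewrite xE yE; apply: mulr_regroup.
rewrite yE; case: (indec _ _ xE1) => [fu_0|vg_0].
  have := adegM_ge f_neq0 u0; rewrite fu_0 leqn0 addn_eq0 => /andP[_ /eqP au].
  have bu : (0 < bdeg u)%N by rewrite lt0n; apply/eqP => bu; apply/nu/is_unitP.
  have le_fu := bdegM_ge f0 au f_neq0 u0.
  apply: factors_mul; first exact: factors_adeg0 au u0.
  apply: (IHm (f * u) v g xE2 fu_0 g0).
  exact: fuel_decr lt_m le_fu bu.
have := adegM_ge v0 g_neq0; rewrite vg_0 leqn0 addn_eq0 => /andP[/eqP av _].
have bv : (0 < bdeg v)%N by rewrite lt0n; apply/eqP => bv; apply/nv/is_unitP.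
have le_vg := bdegM_ge av g0 v0 g_neq0.
apply: factors_mul; last exact: factors_adeg0 av v0.
apply: (IHm f u (v * g) xE1 f0 vg_0).
rewrite addnC in le_vg; rewrite (addnC (bdeg f)) in lt_m; rewrite (addnC (bdeg f)).
exact: fuel_decr lt_m le_vg bv.
Qed.

Lemma KS_factors x : x != 0 -> factors x.
Proof.
elim/ltn_ind: (adeg x) {-2}x (erefl (adeg x)) => n IHn {}x xn x0.
case: (EM (exists u v, [/\ x = u * v, (0 < adeg u)%N & (0 < adeg v)%N])).
  move=> [u [v [xE au av]]].
  have u0 : u != 0 by apply: contraNneq x0 => u0; rewrite xE u0 mul0r.
  have v0 : v != 0 by apply: contraNneq x0 => v0; rewrite xE v0 mulr0.
  have := adegM_ge u0 v0; rewrite -xE xn => le_n.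
  rewrite xE; apply: factors_mul.
    by apply: (IHn (adeg u)); [lia|reflexivity|exact: u0].
  by apply: (IHn (adeg v)); [lia|reflexivity|exact: v0].
move=> no_split; have indec u v : x = u * v -> adeg u = 0%N \/ adeg v = 0%N.
  move=> xE; case: (posnP (adeg u)) => [|au]; first by left.
  case: (posnP (adeg v)) => [|av]; first by right.
  by case: no_split; exists u, v; split; [exact: xE|exact: au|exact: av].
have rx0 := rev_alg_neq0 x0.
case: (EM (forall s, s \in msupp x -> b_divisible s))
  => [x_ld|/existsNP[s1 /not_implyP[s1x s1N]]].
  have [u [z [xE fu _ au]]] := factors_b_divisible x0 x_ld.
  have z0 : z != 0 by apply: contraNneq x0 => z0; rewrite xE z0 mulr0.
  have [u_0|az] := indec _ _ xE; first by move: au; rewrite u_0.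
  by rewrite xE; apply: factors_mul fu _; apply: factors_adeg0 az z0.
case: (EM (forall s, s \in msupp (rev_alg x) -> b_divisible s))
  => [x_ld|/existsNP[s2 /not_implyP[s2x s2N]]].
  have [u [z [xE _ fu au]]] := factors_b_divisible rx0 x_ld.
  have xE' : x = rev_alg z * rev_alg u by rewrite -rev_algM -xE rev_algK.
  have z0 : rev_alg z != 0 by apply: contraNneq x0 => z0; rewrite xE' z0 mul0r.
  have [az|u_0] := indec _ _ xE'.
    by rewrite xE'; apply: factors_mul _ fu; apply: factors_adeg0 az z0.
  by move: au; rewrite -[u]rev_algK rev_alg_adeg0 // u_0.
exact: factors_indecomposable x0 indec s1x s1N s2x s2N.
Qed.

Lemma KS_atomic : is_atomic KS.
Proof. by move=> x /eqP x0; apply: factors_prod; apply: KS_factors. Qed.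

End Atomicity.

(** * Ascending chains and unbounded factorizations *)

Lemma mem_sandwich (T : eqType) (x y u : T) m n k :
  u \in nseq m x ++ nseq n y ++ nseq k x -> u = x \/ u = y.
Proof.
by rewrite !mem_cat !mem_nseq => /or3P[] /andP[_ /eqP]; [left|right|left].
Qed.

Lemma size_sandwich (T : Type) (x y : T) m n k :
  size (nseq m x ++ nseq n y ++ nseq k x) = (m + (n + k))%N.
Proof. by rewrite !size_cat !size_nseq. Qed.

Lemma prod_sandwich (R : nzRingType) (x y : R) m n k :
  (\prod_(u <- nseq m x ++ nseq n y ++ nseq k x) u = x ^+ m * (y ^+ n * x ^+ k))%R.
Proof. by rewrite !big_cat !big_nseq !iter_mulr !mulr1. Qed.

Section IdealChains.
Local Open Scope ring_scope.
Variables (R : nzRingType) (z : nat -> R) (t : R).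
Hypotheses (domR : is_domain R) (z0 : forall n, z n <> 0).

(** If the chain became stationary, then [z N.+1 = z N.+1 * (t * r)] for some N,
    so that [t] would have a right inverse. *)
Lemma not_accp_right_chain : (forall n, z n = z n.+1 * t) ->
  (forall r, 1 <> t * r) -> ~ accp_right R.
Proof.
move=> zE t_nu; case/(_ z) => [n y [r ->]|N zN].
  by exists (t * r); rewrite zE mulrA.
have [|r rE] := proj1 (zN _ (leqnSn N) (z N.+1)); first by exists 1; rewrite mulr1.
have /domR[/z0 //|/eqP] : z N.+1 * (1 - t * r) = 0.
  by rewrite mulrBr mulr1 mulrA -zE -rE subrr.
by rewrite subr_eq0 => /eqP /t_nu.
Qed.

Lemma not_accp_left_chain : (forall n, z n = t * z n.+1) ->
  (forall r, 1 <> r * t) -> ~ accp_left R.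
Proof.
move=> zE t_nu; case/(_ z) => [n y [r ->]|N zN].
  by exists (r * t); rewrite zE mulrA.
have [|r rE] := proj1 (zN _ (leqnSn N) (z N.+1)); first by exists 1; rewrite mul1r.
have /domR[/eqP|/z0 //] : (1 - r * t) * z N.+1 = 0.
  by rewrite mulrBl mul1r -mulrA -zE -rE subrr.
by rewrite subr_eq0 => /eqP /t_nu.
Qed.
End IdealChains.

Section Chains.
Local Open Scope ring_scope.
Variable K : fieldType.
Local Notation KS := (monoid_algebra K Smon).
Implicit Types (x y r : KS) (s : Smon).

Lemma monom_b_not_rinv r : 1 <> monom sb * r.
Proof. by move=> e; have [_ _] := mul_eq1_degs (esym e); rewrite bdeg_monom. Qed.

Lemma monom_b_not_linv r : 1 <> r * monom sb.
Proof. by move=> e; have [_ _ _] := mul_eq1_degs (esym e); rewrite bdeg_monom. Qed.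

Lemma sbX_sa2_step n : (sb ^+ n.+1 * sa ^+ 2 * sb = sb ^+ n * sa ^+ 2)%g.
Proof.
rewrite expgSr; move: (sa ^+ 2)%g sb_sa2_sb => t btb.
by rewrite -(mulgA _ sb t) -mulgA btb.
Qed.

Lemma sa2_sbX_step n : (sb * (sa ^+ 2 * sb ^+ n.+1) = sa ^+ 2 * sb ^+ n)%g.
Proof.
rewrite [(sb ^+ n.+1)%g]expgS; move: (sa ^+ 2)%g sb_sa2_sb => t btb.
by rewrite !mulgA btb.
Qed.

Lemma not_accp_right : ~ accp_right KS.
Proof.
apply: (@not_accp_right_chain KS (fun n => monom (sb ^+ n * sa ^+ 2)%g) (monom sb)).
- exact: KS_domain.
- by move=> n; apply/eqP/monom_neq0.
- by move=> n; rewrite monomM_Smon sbX_sa2_step.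
exact: monom_b_not_rinv.
Qed.

Lemma not_accp_left : ~ accp_left KS.
Proof.
apply: (@not_accp_left_chain KS (fun n => monom (sa ^+ 2 * sb ^+ n)%g) (monom sb)).
- exact: KS_domain.
- by move=> n; apply/eqP/monom_neq0.
- by move=> n; rewrite monomM_Smon sa2_sbX_step.
exact: monom_b_not_linv.
Qed.

Lemma not_bounded_factorizations : ~ has_bounded_factorizations KS.
Proof.
move=> [_ /(_ (monom (sa ^+ 2)%g))[|l bounded]]; first exact/eqP/monom_neq0.
(* The factorization a^2 = b^n a a b^n with n = l + 1. *)
pose r : seq KS := nseq l.+1 (monom sb) ++ nseq 2 (monom sa) ++ nseq l.+1 (monom sb).
have : (size r <= l)%N.
  apply: bounded => [u|]; rewrite /r.
    by move=> /mem_sandwich[] ->; [exact: atom_b|exact: atom_a].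
  apply: etrans (esym (prod_sandwich (monom sb) (monom sa) l.+1 2 l.+1)).
  have bX := monomX K sb l.+1; have aX := monomX K sa 2.
  apply: etrans (esym (congr2 *%R bX (congr2 *%R aX bX))).
  apply: etrans (esym (congr1 ( *%R _) (monomM_Smon K _ _))).
  apply: etrans (esym (monomM_Smon K _ _)); congr monom.
  by rewrite mulgA sb_sa2_sbX.
rewrite size_sandwich; lia.
Qed.
End Chains.

Local Open Scope ring_scope.

Theorem proposition7p6 (K : fieldType) :
  let KS : algType K := monoid_algebra K Smon in
  let a : KS := monom sa in
  let b : KS := monom sb in
  let x : free_algebra K 2 := fvar K ord0 in
  let y : free_algebra K 2 := fvar K ord_max in
  [/\ presented_by [tuple a; b]
        [:: (y * x ^+ 2 * y, x ^+ 2); (x ^+ 4 * y, y * x ^+ 4)]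
      /\ finitely_presented KS,
      is_domain KS,
      is_atomic KS,
      ~ accp_right KS /\ ~ accp_left KS
    & ~ has_bounded_factorizations KS].
Proof.
move=> KS a b x y; split.
- split; first exact: presented_KS.
  by exists 2; eexists; eexists; apply: presented_KS.
- exact: KS_domain.
- exact: KS_atomic.
- by split; [apply: not_accp_right|apply: not_accp_left].
exact: not_bounded_factorizations.
Qed.
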